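(* Let $N(k)>0$ and $\delta(k)>0$ be sequences indexed by positive integers $k$. Assume that there is $\eta<1$ such that $$\frac{N(k)}{k^{\eta}\delta(k)^2}\to 0 \quad\text{and}\quad \frac{N(k)^{3/2}}{k^{\eta}\delta(k)}\to 0 \qquad (k\to\infty).$$ Then for almost every $g\in \mathrm{SL}_3(\mathbb{R})$ (with respect to Haar measure), the indefinite ternary quadratic form $Q(v)=Q_0(vg)$, where $Q_0(x,y,z)=x^2+y^2-z^2$, has the following property: there are constants $c=c(Q)>0$ and $T_0=T_0(Q)>0$ such that for all $k\geq T_0$, $$\max_{|\xi|\leq N(k)}\ \min_{n\in\mathbb{Z}^3,\ \|n\|\leq ck} |Q(n)-\xi|\leq \delta(k).$$
   Context: Vectors $v\in\mathbb{R}^3$ are row vectors and $\mathrm{SL}_3(\mathbb{R})$ acts on them by right multiplication $v\mapsto vg$; $\|n\|$ denotes the Euclidean norm. Every determinant-one indefinite ternary quadratic form is of the form $Q_0(vg)$ for some $g\in\mathrm{SL}_3(\mathbb{R})$, and the space of such forms up to $\mathrm{SL}_3(\mathbb{Z})$-equivalence is identified with $X_3=\mathrm{SL}_3(\mathbb{Z})\backslash \mathrm{SL}_3(\mathbb{R})$ with its Haar probability measure; ''almost every form'' refers to this measure (equivalently, Haar-almost every $g$). *)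

(* Defs.v *)
From HB Require Import structures.
From mathcomp Require Import all_boot all_order all_algebra.
From mathcomp Require Import all_classical all_reals all_analysis.

Set Implicit Arguments.
Unset Strict Implicit.
Unset Printing Implicit Defensive.

Import Order.TTheory GRing.Theory Num.Theory.
Import numFieldNormedType.Exports.

Local Open Scope classical_set_scope.
Local Open Scope ring_scope.

(* As a [set_type], SL_3(R) carries the topology induced from 'M[R]_3. *)
Definition SL3 (R : realType) : Type :=
  set_type [set g : 'M[R]_3 | \det g = 1].

HB.instance Definition _ (R : realType) := SubType.on (SL3 R).
HB.instance Definition _ (R : realType) := Choice.on (SL3 R).
HB.instance Definition _ (R : realType) := Topological.on (SL3 R).

Section SL3Group.
Variable R : realType.
Implicit Types g h : SL3 R.

Lemma det_SL3 g : \det (\val g) = 1.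
Proof. by have := valP g; rewrite inE. Qed.

Definition SL3_of (a : 'M[R]_3) (da : \det a = 1) : SL3 R :=
  exist _ a (mem_set da).

Definition SL3_one : SL3 R := SL3_of (det1 R 3).

Fact SL3_mul_subproof g h : \det (\val g *m \val h) = 1.
Proof. by rewrite det_mulmx !det_SL3 mulr1. Qed.

Definition SL3_mul g h : SL3 R := SL3_of (SL3_mul_subproof g h).

Fact SL3_inv_subproof g : \det (invmx (\val g)) = 1.
Proof. by rewrite det_inv det_SL3 invr1. Qed.

Definition SL3_inv g : SL3 R := SL3_of (SL3_inv_subproof g).

Fact SL3_mulA : associative SL3_mul.
Proof. by move=> g h k; apply: val_inj; rewrite /= mulmxA. Qed.

Fact SL3_mul1g : left_id SL3_one SL3_mul.
Proof. by move=> g; apply: val_inj; rewrite /= mul1mx. Qed.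

Fact SL3_mulg1 : right_id SL3_one SL3_mul.
Proof. by move=> g; apply: val_inj; rewrite /= mulmx1. Qed.

Fact SL3_mulVg : left_inverse SL3_one SL3_inv SL3_mul.
Proof.
by move=> g; apply: val_inj; rewrite /= mulVmx // unitmxE det_SL3 unitr1.
Qed.

Fact SL3_mulgV : right_inverse SL3_one SL3_inv SL3_mul.
Proof.
by move=> g; apply: val_inj; rewrite /= mulmxV // unitmxE det_SL3 unitr1.
Qed.

HB.instance Definition _ := isGroup.Build (SL3 R)
  SL3_mulA SL3_mul1g SL3_mulg1 SL3_mulVg SL3_mulgV.

HB.instance Definition _ := isPointed.Build (SL3 R) SL3_one.

End SL3Group.

Notation borelSL3 R := (g_sigma_algebraType (@open (SL3 R))).

(* Left Haar measures on SL_3(R). The group is locally compact, second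
   countable and Hausdorff, so regularity follows from finiteness on compact
   sets and is not required separately. *)
Definition haar_measure (R : realType)
    (mu : {measure set (borelSL3 R) -> \bar R}) : Prop :=
  [/\ forall (g : SL3 R) (A : set (SL3 R)), <<s @open (SL3 R) >> A ->
        mu [set (g * a)%g | a in A] = mu A,
      forall K : set (SL3 R), compact K -> (mu K < +oo)%E
    & mu [set: SL3 R] != 0%E].

(* The library's norm on row vectors is the sup norm. *)
Definition enorm (R : realType) (n : nat) (v : 'rV[R]_n) : R :=
  Num.sqrt (\sum_i v 0 i ^+ 2).

Definition Q0 (R : realType) (v : 'rV[R]_3) : R :=
  v 0 0 ^+ 2 + v 0 1 ^+ 2 - v 0 2 ^+ 2.

Definition Qform (R : realType) (g : SL3 R) (v : 'rV[R]_3) : R :=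
  Q0 (v *m \val g).

Definition intvec (R : realType) (n : 'rV[int]_3) : 'rV[R]_3 :=
  map_mx intr n.

(* Taken in the extended reals, so that no default value of [sup] or [inf]
   intervenes; for 0 <= N and 0 <= r, with Q continuous, the infimum is a
   minimum over a finite nonempty set and the supremum is a maximum. *)
Definition maxmin (R : realType) (Q : 'rV[R]_3 -> R) (N r : R) : \bar R :=
  ereal_sup [set
      ereal_inf [set `|Q (intvec R n) - xi|%:E
                | n in [set n : 'rV[int]_3 | enorm (intvec R n) <= r]]
    | xi in [set xi : R | `|xi| <= N]].

(* Main.v *)
(* Fix a lattice vector c with Q(c) < 0 and integer vectors a, b independent of
   c. The unipotents u_s, s in R^2, fixing c and moving a, b by s_1 c, s_2 c
   turn the values of the form into
     Q(l_1 a + l_2 b + (m + l.s) c) = q(l) - alpha (m + l.s - beta.l)^2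
   with q positive definite. For |l| of order K, the value for some m is within
   d of xi when l.s mod 1 lies in an interval of length of order d / K, and for
   coprime l these events are exactly pairwise independent in s on the torus
   R^2 / Z^2. By Chebyshev they all fail with probability O(1 / (K d)).
   Taking K = 2^i and summing over a grid of O(K^2) values xi = +-u^2 K^-eta,
   with d = u K^-eta, the failure probability is O(K^(eta - 1) log K), which is
   summable in i. Borel-Cantelli gives the claim for u_s h, for all h with
   Q_h(c) < 0 and almost all s; Fubini and left invariance make it hold for
   Haar-almost every g with Q_g(c) < 0, and countably many c suffice. *)
From HB Require Import structures.
Require Import Defs.
From mathcomp Require Import all_boot all_order all_algebra.
From mathcomp Require Import all_classical all_reals all_analysis.
From mathcomp Require Import measurable_realfun.
From mathcomp Require Import zify ring lra.

Set Implicit Arguments.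
Unset Strict Implicit.
Unset Printing Implicit Defensive.

Import Order.TTheory GRing.Theory Num.Theory.
Import numFieldNormedType.Exports.

Local Open Scope classical_set_scope.
Local Open Scope ring_scope.

(** * The unit interval as a circle *)

(** The parabola is inverted rather than estimated: the value at (l, m) equals xi exactly when m +
    l.s = beta.l + sqrt((q(l) - xi) / alpha), and an overshoot t past this root lowers the value by
    alpha t (2 sqrt(...) + t). Having q(l) >= |xi| keeps the roots real, whence targets up to K^2
    and pairs l bounded below; roots of order K give the interval length d / K. The grid is
    quadratic so that its gaps match a precision growing like sqrt |xi|, which is what the first
    rate condition leaves for targets of size N. The failure probabilities then add up to a harmonic
    sum in u in which neither N nor delta occurs. The good set is thus determined by eta alone, and
    one event per dyadic block serves every k in it, whereas a grid adapted to N(k) and delta(k)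
    would change with each k. The second rate condition enters only through the range: when delta <
    N it gives N <= K^(2 eta) <= K^2 for large k. When N <= delta, the zero vector already
    suffices. *)

Section UnitInterval.
Context {R : realType}.
Implicit Types (x r : R) (A : set R).

Lemma measurable_translate r :
  measurable_fun setT (fun x : measurableTypeR R => (x + r)%R : measurableTypeR R).
Proof. exact: measurable_funD. Qed.

Lemma lebesgue_measure_translate r A : measurable A ->
  lebesgue_measure ((fun x => x + r) @^-1` A) = lebesgue_measure A.
Proof.
move=> mA.
pose phi : {mfun measurableTypeR R >-> measurableTypeR R} :=
  HB.pack (fun x : measurableTypeR R => (x + r : measurableTypeR R))
          (isMeasurableFun.Build _ _ _ _ _ (measurable_translate r)).
apply/esym/(@lebesgue_measure_unique _ (pushforward lebesgue_measure phi)) => //.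
move=> _ [[a b]] _ <-.
rewrite [RHS](_ : _ = lebesgue_measure [set` `](a - r), (b - r)]%R]); last first.
  congr lebesgue_measure.
  by apply/seteqP; split => x /=; rewrite !in_itv /= ltrBlDr lerBrDr.
rewrite !lebesgue_measure_itv /= !lte_fin ltrD2r; case: ifP => // _.
by rewrite -!EFinD; congr (_%:E); ring.
Qed.

(** The circle is encoded as a measure on all of R carried by [0, 1), not as a quotient, so that
    linear forms in s remain ordinary real functions. Periodicity becomes a condition on integrands,
    and confinement to the unit square has to be stated where it matters. *)
Definition unif01 : set (measurableTypeR R) -> \bar R :=
  mrestr lebesgue_measure (measurable_itv (`[0, 1[%R : interval R)).

HB.instance Definition _ := Measure.on unif01.

Lemma unif01_setT : unif01 setT = 1%E.
Proof.
by rewrite /unif01 /mrestr setTI lebesgue_measure_itv /= lte_fin ltr01 oppr0 adde0.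
Qed.

HB.instance Definition _ := Measure_isProbability.Build _ _ _ unif01 unif01_setT.

Definition frac x : R := x - (Num.floor x)%:~R.

Lemma frac_ge0 x : 0 <= frac x.
Proof. by rewrite /frac subr_ge0 floor_le_tmp. Qed.

Lemma frac_lt1 x : frac x < 1.
Proof. by rewrite /frac ltrBlDr addrC; have := floorD1_gt x; rewrite intrD. Qed.

Lemma frac_id x : 0 <= x < 1 -> frac x = x.
Proof.
by move=> /andP[x0 x1]; rewrite /frac (floor_def (m := 0)) ?subr0// x0 add0r.
Qed.

Lemma fracDz x (m : int) : frac (x + m%:~R) = frac x.
Proof. by rewrite /frac floorDrz ?intr_int// intrKfloor intrD; ring. Qed.

Lemma measurable_frac : measurable_fun setT frac.
Proof.
move=> _ A mA; rewrite setTI.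
rewrite (_ : _ @^-1` _ = \bigcup_(m : int)
   (`[m%:~R, (m + 1)%:~R[ `&` (fun x => x + (- m%:~R)) @^-1` A)); last first.
  apply/seteqP; split => x.
    move=> Ax; exists (Num.floor x) => //; split => //=.
    by rewrite in_itv /= floor_le_tmp floorD1_gt.
  move=> [m _ [/=]]; rewrite in_itv /= => mx.
  by rewrite /frac (floor_def mx).
apply: countable_bigcupT_measurable => // m; apply: measurableI => //.
by rewrite -[X in measurable X]setTI; apply: measurable_translate.
Qed.

(** Rotation by [s = frac r] cuts the circle into two arcs: points landing in [s, 1) are translated
    by s, points landing in [0, s) wrap around and are translated by s - 1. Each piece is handled by
    translation invariance on the line. *)
Lemma unif01_frac_translate r A : measurable A ->
  unif01 ((fun x => frac (x + r)) @^-1` A) = unif01 A.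
Proof.
move=> mA.
have tr0 : (fun x => frac (x + r)) = (fun x => frac (x + frac r)).
  apply/funext => x; rewrite -(fracDz (x + frac r) (Num.floor r)).
  by rewrite -addrA /frac subrK.
rewrite tr0 {tr0}; set s := frac r.
have s0 : 0 <= s := frac_ge0 r.
have s1 : s < 1 := frac_lt1 r.
have mAs : measurable (A `&` `[s, 1[) by exact: measurableI.
have mA0 : measurable (A `&` `[0, s[) by exact: measurableI.
have mt t (B : set R) : measurable B ->
    measurable ((fun x : R => x + t) @^-1` B).
  by move=> mB; rewrite -[X in measurable X]setTI; apply: measurable_translate.
rewrite /unif01 /mrestr.
rewrite (_ : _ `&` _ = (fun x => x + s) @^-1` (A `&` `[s, 1[) `|`
    (fun x => x + (s - 1)) @^-1` (A `&` `[0, s[)); last first.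
  apply/seteqP; split => x /=; rewrite !in_itv /=.
    move=> [Ax /andP[x0 x1]]; have [xs|xs] := ltP (x + s) 1.
      left; split; last by apply/andP; split; lra.
      by rewrite -[X in A X]frac_id //; apply/andP; split; lra.
    right; split; last by apply/andP; split; lra.
    rewrite addrA -[X in A X]frac_id; last by apply/andP; split; lra.
    by rewrite (fracDz _ (-1)).
  move=> [] [Ax /andP[a b]]; split.
  - by rewrite frac_id // b andbT; lra.
  - by apply/andP; split; lra.
  - rewrite -(fracDz _ (-1)) frac_id; first by rewrite -addrA.
    by apply/andP; split; lra.
  - by apply/andP; split; lra.
rewrite measureU; [|exact: mt|exact: mt|]; last first.
  rewrite -subset0 => x /= [[_]] /[!in_itv] /= /andP[a b] [_ /andP[c d]]; lra.
transitivity (lebesgue_measure (A `&` `[s, 1%R[) +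
              lebesgue_measure (A `&` `[0%R, s[))%E.
  by congr (_ + _)%E; exact: lebesgue_measure_translate.
rewrite -measureU //; last first.
  rewrite -subset0 => x /= [[_]] /[!in_itv] /= /andP[a b] [_ /andP[c d]]; lra.
rewrite -setIUr; congr (lebesgue_measure (A `&` _)).
rewrite setUC; apply/seteqP; split => x /=; rewrite !in_itv /=.
  by case=> /andP[a b]; apply/andP; split; lra.
by move=> /andP[a b]; have [] := ltP x s; [left|right]; apply/andP; split; lra.
Qed.

Local Open Scope ereal_scope.

Definition periodic1 (f : R -> \bar R) := forall x (m : int), f (x + m%:~R)%R = f x.

Lemma periodic1_frac f x : periodic1 f -> f (frac x) = f x.
Proof.
move=> pf; rewrite /frac.
by rewrite -[RHS](pf _ (- Num.floor x)%R) intrN.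
Qed.

Lemma integral_unif01_translate (f : R -> \bar R) r :
  measurable_fun setT f -> (forall x, 0 <= f x) -> periodic1 f ->
  \int[unif01]_x f (x + r)%R = \int[unif01]_x f x.
Proof.
move=> mf f0 pf.
have mphi : measurable_fun setT (fun x : measurableTypeR R => frac (x + r)
  : measurableTypeR R).
  by apply: measurableT_comp (measurable_translate r); exact: measurable_frac.
pose phi : {mfun measurableTypeR R >-> measurableTypeR R} :=
  HB.pack (fun x : measurableTypeR R => (frac (x + r) : measurableTypeR R))
          (isMeasurableFun.Build _ _ _ _ _ mphi).
transitivity (\int[unif01]_(x in phi @^-1` setT) (f \o phi) x).
  rewrite preimage_setT; apply: eq_integral => x _ /=.
  by rewrite periodic1_frac.
rewrite -(ge0_integral_pushforward mphi) //.
apply: eq_measure_integral => A mA _ /=.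
exact: unif01_frac_translate.
Qed.

End UnitInterval.

(** * Linear forms on the torus *)

Section Torus.
Context {R : realType}.
Local Open Scope ereal_scope.
Local Notation u := (@unif01 R).
Local Notation MR := (measurableTypeR R).
Implicit Types (F : MR * MR -> \bar R) (f g : MR -> \bar R).

Definition torus : set (measurableTypeR R * measurableTypeR R) -> \bar R := u \x u.
HB.instance Definition _ := Measure.on torus.

Lemma torus_setT : torus setT = 1.
Proof.
by rewrite /torus -setXTT product_measure1E//= !unif01_setT mule1.
Qed.

HB.instance Definition _ := Measure_isProbability.Build _ _ _ torus torus_setT.

Lemma torus_translate F (r t : R) :
  measurable_fun setT F -> (forall z, 0 <= F z) ->
  (forall x, periodic1 (fun y => F (x, y))) ->
  (forall y, periodic1 (fun x => F (x, y))) ->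
  \int[torus]_z F ((z.1 + r)%R, (z.2 + t)%R) = \int[torus]_z F z.
Proof.
move=> mF F0 p2 p1; rewrite /torus.
have m1 : measurable_fun setT (fun z : MR * MR => F ((z.1 + r)%R, z.2)).
  by apply: measurableT_comp => //; apply: measurable_fun_pair => //=;
    apply: measurable_funD.
have m2 : measurable_fun setT (fun z : MR * MR => F ((z.1 + r)%R, (z.2 + t)%R)).
  by apply: measurableT_comp => //; apply: measurable_fun_pair => //=;
    apply: measurable_funD.
rewrite fubini_tonelli1 //.
transitivity (\int[u]_x \int[u]_y F ((x + r)%R, y)).
  apply: eq_integral => x _; rewrite /fubini_F /=.
  apply: (integral_unif01_translate (f := fun y => F ((x + r)%R, y))) => //.
  exact: measurableT_comp.
transitivity (\int[u]_y \int[u]_x F ((x + r)%R, y)).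
  exact: (fubini_tonelli (fun z : MR * MR => F ((z.1 + r)%R, z.2))).
rewrite fubini_tonelli2 //; apply: eq_integral => y _.
apply: (integral_unif01_translate (f := fun x => F (x, y))) => //.
exact: measurableT_comp.
Qed.

Definition ldot (l : int * int) (z : MR * MR) : MR := (l.1%:~R * z.1 + l.2%:~R * z.2)%R.
Definition ldet (l l' : int * int) : int := (l.1 * l'.2 - l.2 * l'.1)%R.

Lemma measurable_ldot l : measurable_fun setT (ldot l).
Proof. by apply: measurable_funD; apply: measurable_funM. Qed.

Lemma periodic1_ldot1 f l y : periodic1 f -> periodic1 (fun x => f (ldot l (x, y))).
Proof.
move=> pf x m; rewrite -[RHS](pf _ (l.1 * m)%R) /ldot /= intrM.
by congr f; ring.
Qed.

Lemma periodic1_ldot2 f l x : periodic1 f -> periodic1 (fun y => f (ldot l (x, y))).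
Proof.
move=> pf y m; rewrite -[RHS](pf _ (l.2 * m)%R) /ldot /= intrM.
by congr f; ring.
Qed.

(** Translating the torus in the direction annihilated by [l'] moves the argument of f freely and
    leaves that of g alone. Averaging over this translation replaces f by its mean. *)
Lemma torus_decouple f g l l' :
  measurable_fun setT f -> measurable_fun setT g ->
  (forall x, 0 <= f x) -> (forall x, 0 <= g x) ->
  periodic1 f -> periodic1 g -> (ldet l l' != 0)%R ->
  \int[torus]_z (f (ldot l z) * g (ldot l' z)) =
  (\int[u]_x f x) * \int[torus]_z g (ldot l' z).
Proof.
move=> mf mg f0 g0 pf pg D0.
have D0' : (ldet l l')%:~R != 0%R :> R by rewrite intr_eq0.
have mfl := measurableT_comp mf (measurable_ldot l).
have mgl := measurableT_comp mg (measurable_ldot l').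
pose G (z : MR * MR) (x : MR) := f (ldot l z + x)%R * g (ldot l' z).
have mG : measurable_fun setT (fun w : (MR * MR) * MR => G w.1 w.2).
  apply: emeasurable_funM.
    apply: measurableT_comp => //; apply: measurable_funD => //.
    by apply: measurableT_comp => //; exact: measurable_ldot.
  by apply: (measurableT_comp mgl).
have shift x : \int[torus]_z (f (ldot l z) * g (ldot l' z)) =
    \int[torus]_z G z x.
  pose d : R := (ldet l l')%:~R.
  (* Cramer's rule: this vector v solves l.v = x and l'.v = 0. *)
  rewrite -(torus_translate (x * l'.2%:~R / d)%R (- x * l'.1%:~R / d)%R) //.
  - apply: eq_integral => z _; rewrite /G; congr (f _ * g _).
      rewrite /ldot /= /d /ldet; move: D0'; rewrite /ldet intrB !intrM => D0'.
      by field.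
    rewrite /ldot /= /d /ldet; move: D0'; rewrite /ldet intrB !intrM => D0'.
    by field.
  - exact: emeasurable_funM.
  - by move=> z; rewrite mule_ge0.
  - by move=> y x0 m; rewrite periodic1_ldot2 // (periodic1_ldot2 l' _ pg).
  - by move=> y x0 m; rewrite periodic1_ldot1 // (periodic1_ldot1 l' _ pg).
transitivity (\int[u]_x \int[torus]_z G z x).
  transitivity (\int[u]_x (cst (\int[torus]_z (f (ldot l z) * g (ldot l' z))) x)).
    by rewrite integral_cst //= unif01_setT mule1.
  by apply: eq_integral => x _ /=; exact: shift.
rewrite -(fubini_tonelli (fun w : (MR * MR) * MR => G w.1 w.2)) //=; last first.
  by move=> w; rewrite mule_ge0.
rewrite -ge0_integralZl //; last exact: integral_ge0.
apply: eq_integral => z _; rewrite /G ge0_integralZr //.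
- congr (_ * _); under eq_integral do rewrite addrC.
  exact: integral_unif01_translate.
- by apply: measurableT_comp => //; exact: measurable_funD.
Qed.

(** Decoupling against the constant 1 along the perpendicular of [l], for which the determinant is
    l_1^2 + l_2^2. *)
Lemma torus_ldot g l : measurable_fun setT g -> (forall x, 0 <= g x) ->
  periodic1 g -> l != (0, 0)%R -> \int[torus]_z g (ldot l z) = \int[u]_x g x.
Proof.
move=> mg g0 pg l0.
have := @torus_decouple g (cst 1) l (- l.2, l.1)%R mg (measurable_cst _) g0.
have -> : \int[torus]_z (cst 1 (ldot (- l.2, l.1)%R z)) = 1.
  by rewrite integral_cst//= torus_setT mule1.
rewrite mule1 => <- //; first by apply: eq_integral => z _; rewrite mule1.
rewrite /ldet /= mulrN opprK -!expr2 paddr_eq0 ?sqr_ge0 // !sqrf_eq0.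
by apply: contra l0; case: l => a b /= /andP[/eqP-> /eqP->].
Qed.

(** * Arcs of the circle and their pullbacks to the torus *)

Definition frac_lt (c lam : R) : set R := [set x | (frac (x - c) < lam)%R].

Lemma measurable_frac_lt c lam : measurable (frac_lt c lam).
Proof.
have mf : measurable_fun setT (fun x : MR => frac (x - c)%R).
  by apply: measurableT_comp; [exact: measurable_frac|exact: measurable_funD].
rewrite (_ : frac_lt _ _ =
    setT `&` (fun x : MR => frac (x - c)%R) @^-1` `]-oo, lam[%classic).
  exact: mf.
by rewrite setTI; apply/seteqP; split => x; rewrite /frac_lt /= in_itv.
Qed.

Lemma unif01_frac_lt c lam : (0 <= lam <= 1)%R -> u (frac_lt c lam) = lam%:E.
Proof.
move=> /andP[l0 l1].
have := @unif01_frac_translate R (- c)%R `]-oo, lam[%classic (measurable_itv _).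
rewrite (_ : _ @^-1` _ = frac_lt c lam); last first.
  by apply/seteqP; split => x; rewrite /frac_lt /= in_itv.
move=> ->; rewrite /unif01 /mrestr.
rewrite (_ : _ `&` _ = `[0%R, lam[%classic); last first.
  apply/seteqP; split => x /=; rewrite !in_itv /=; first by case=> ? /andP[-> _].
  by move=> /andP[-> xl]; rewrite xl (lt_le_trans xl l1).
by rewrite lebesgue_measure_itv /= lte_fin; case: ltgtP l0 => // [_|<-] _;
  rewrite ?oppr0 ?adde0.
Qed.

Definition hits (l : int * int) (c lam : R) : set (MR * MR) :=
  [set z | frac_lt c lam (ldot l z)].

Lemma measurable_hits l c lam : measurable (hits l c lam).
Proof.
by rewrite -[X in measurable X]setTI; apply: (measurable_ldot l) => //;
  exact: measurable_frac_lt.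
Qed.

Let ind c lam : MR -> \bar R := fun x => (\1_(frac_lt c lam) x)%:E.

Let mind c lam : measurable_fun setT (ind c lam).
Proof. by apply/measurable_EFinP/measurable_indic; exact: measurable_frac_lt. Qed.

Let pind c lam : periodic1 (ind c lam).
Proof.
move=> x m; rewrite /ind !indicE; congr (_%:R%:E); congr nat_of_bool.
by apply/idP/idP; rewrite !inE /frac_lt /= addrAC fracDz.
Qed.

Let ind0 c lam x : 0 <= ind c lam x. Proof. by rewrite lee_fin. Qed.

Let indE c lam : (0 <= lam <= 1)%R -> \int[u]_x ind c lam x = lam%:E.
Proof.
move=> lam01; rewrite -(unif01_frac_lt c) // -[in RHS](setIT (frac_lt c lam)).
by apply: integral_indic => //; exact: measurable_frac_lt.
Qed.

Lemma torus_hits l c lam : (0 <= lam <= 1)%R -> l != (0, 0)%R ->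
  torus (hits l c lam) = lam%:E.
Proof.
move=> lam01 l0; rewrite -(indE c) // -(@torus_ldot (ind c lam) l) //.
rewrite -[in LHS](setIT (hits l c lam)) -integral_indic //; exact: measurable_hits.
Qed.

Lemma torus_hitsI l l' c c' lam lam' :
  (0 <= lam <= 1)%R -> (0 <= lam' <= 1)%R -> (ldet l l' != 0)%R ->
  torus (hits l c lam `&` hits l' c' lam') = (lam * lam')%:E.
Proof.
move=> lam01 lam'01 D0.
have l'0 : l' != (0, 0)%R by apply: contra D0 => /eqP ->; rewrite /ldet !mulr0.
rewrite EFinM -(indE c) // -(indE c' lam'01) -(@torus_ldot (ind c' lam') l') //.
rewrite -(@torus_decouple (ind c lam) (ind c' lam') l l') //.
rewrite -[in LHS](setIT (_ `&` _)) -integral_indic //; last first.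
  by apply: measurableI; exact: measurable_hits.
by apply: eq_integral => z _; rewrite indicI EFinM.
Qed.

End Torus.

(** * Pairwise independent events *)

Section PairwiseIndependence.
Context d (T : measurableType d) (R : realType) (P : probability T R).
Local Open Scope ereal_scope.

(* Chebyshev's inequality with all terms moved so as to be nonnegative: if X
   counts the events and mu is its mean, then mu^2 1_(X = 0) + 2 mu X <= X^2 + mu^2. *)
Lemma pairwise_independent_miss (I : choiceType) (s : seq I) (E : I -> set T)
    (lam : R) :
  uniq s -> (forall i, measurable (E i)) -> (0 < lam)%R -> (0 < size s)%N ->
  (forall i, i \in s -> P (E i) = lam%:E) ->
  (forall i j, i \in s -> j \in s -> i != j -> P (E i `&` E j) = (lam ^+ 2)%:E) ->
  P [set z | forall i, i \in s -> ~ E i z] <= ((size s)%:R * lam)^-1%:E.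
Proof.
move=> us mE lam0 s0 PE PEE.
pose n : R := (size s)%:R; pose mu : R := (n * lam)%R.
have n0 : (0 < n)%R by rewrite ltr0n.
have mu0 : (0 < mu)%R by rewrite mulr_gt0.
set B := [set z | _].
have BE : B = ~` (\bigcup_(i in [set` s]) E i).
  apply/seteqP; split => z /=; first by move=> Bz [i /= si]; exact: Bz.
  by move=> nE i si Ei; apply: nE; exists i.
have mB : measurable B.
  rewrite BE; apply: measurableC; rewrite bigcup_seq.
  exact: bigsetU_measurable.
pose X z : R := (\sum_(i <- s) \1_(E i) z)%R.
have mI A : measurable A -> measurable_fun setT (fun z : T => (\1_A z)%:E : \bar R).
  by move=> mA; apply/measurable_EFinP/measurable_indic.
have I0 A (z : T) : 0 <= (\1_A z)%:E :> \bar R by rewrite lee_fin.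
have iI A : measurable A -> \int[P]_z (\1_A z)%:E = P A.
  by move=> mA; rewrite integral_indic // setIT.
pose W (z : T) : \bar R := \sum_(i <- s) \sum_(j <- s) (\1_(E i `&` E j) z)%:E.
have XE z : (X z)%:E = \sum_(i <- s) (\1_(E i) z)%:E by rewrite /X sumEFin.
have mX : measurable_fun setT (fun z => (X z)%:E).
  under eq_fun do rewrite XE.
  by apply: emeasurable_sum => i; exact: mI.
have mW1 i :
    measurable_fun setT (fun z => \sum_(j <- s) (\1_(E i `&` E j) z)%:E : \bar R).
  by apply: emeasurable_sum => j; apply: mI; exact: measurableI.
have mW : measurable_fun setT W by exact: emeasurable_sum.
have W0 z : 0 <= W z by apply: sume_ge0 => i _; exact: sume_ge0.
have X0 z : (0 <= X z)%R by apply: sumr_ge0.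
have WE z : W z = (X z ^+ 2)%:E.
  rewrite /W expr2 /X mulr_suml -sumEFin; apply: eq_bigr => i _.
  rewrite mulr_sumr -sumEFin; apply: eq_bigr => j _.
  by rewrite indicI.
have intX : \int[P]_z (X z)%:E = mu%:E.
  under eq_integral do rewrite XE.
  rewrite ge0_integral_sum //; last by move=> i; exact: mI.
  rewrite (eq_big_seq (fun=> lam%:E)); last by move=> i si; rewrite iI // PE.
  by rewrite sumEFin big_const_seq count_predT iter_addr_0 /mu /n mulr_natl.
have intW : \int[P]_z W z <= (mu + mu ^+ 2)%:E.
  rewrite ge0_integral_sum //; last by move=> i z _; exact: sume_ge0.
  apply: (@le_trans _ _ (\sum_(i <- s) (lam + n * lam ^+ 2)%:E)); last first.
    rewrite sumEFin big_const_seq count_predT iter_addr_0 -mulr_natl -/n lee_fin.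
    by rewrite le_eqVlt; apply/orP; left; apply/eqP; rewrite /mu; ring.
  rewrite big_seq_cond [leRHS]big_seq_cond; apply: lee_sum => i /andP[si _].
  rewrite ge0_integral_sum //; last by move=> j; apply: mI; exact: measurableI.
  (* The diagonal term, equal to lam, is overestimated by lam + lam^2, so that the whole row is
     bounded by one formula. *)
  apply: (@le_trans _ _ (\sum_(j <- s) (((j == i)%:R * lam)%R + lam ^+ 2)%:E)).
    rewrite big_seq_cond [leRHS]big_seq_cond; apply: lee_sum => j /andP[sj _].
    rewrite iI; last exact: measurableI.
    have [->|ji] := eqVneq j i.
      by rewrite setIid PE // lee_fin mul1r lerDl sqr_ge0.
    by rewrite PEE 1?eq_sym // lee_fin mul0r add0r.
  rewrite sumEFin lee_fin big_split /= big_const_seq count_predT iter_addr_0.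
  rewrite -mulr_suml -mulr_natl -/n lerD2r.
  rewrite -natr_sum.
  have -> : (\sum_(j <- s) (j == i) = count_mem i s)%N.
    by rewrite -sum1_count [RHS]big_mkcond; apply: eq_bigr => j _ /=; case: eqP.
  rewrite -[leRHS]mul1r ler_wpM2r ?(ltW lam0)//.
  rewrite -[1%R]/(1%:R) ler_nat.
  by rewrite (count_uniq_mem i us) leq_b1.
(* With E X = mu and E X^2 <= mu + mu^2, integrating the pointwise inequality gives mu^2 P(B) <=
   mu. *)
have key : (mu ^+ 2)%:E * P B + (2 * mu)%:E * mu%:E <= (mu + mu ^+ 2)%:E + (mu ^+ 2)%:E.
  apply: (@le_trans _ _ (\int[P]_z (W z + (mu ^+ 2)%:E))); last first.
    rewrite ge0_integralD //; last by move=> z _; rewrite lee_fin sqr_ge0.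
    have -> : \int[P]_z (mu ^+ 2)%:E = (mu ^+ 2)%:E
      by rewrite (integral_cst P measurableT) -[RHS]mule1; congr (_ * _);
        exact: probability_setT.
    by rewrite leeD2r.
  have mu20 : (0 <= 2 * mu)%R by rewrite mulr_ge0 // ltW.
  have -> : (mu ^+ 2)%:E * P B = \int[P]_z ((mu ^+ 2)%:E * (\1_B z)%:E).
    by rewrite ge0_integralZl_EFin ?iI ?sqr_ge0 //; exact: mI.
  have -> : (2 * mu)%:E * mu%:E = \int[P]_z ((2 * mu)%:E * (X z)%:E).
    by rewrite ge0_integralZl_EFin ?intX // => z _; rewrite lee_fin.
  have mXmu : measurable_fun setT (fun z => (2 * mu)%:E * (X z)%:E).
    exact: measurable_funeM.
  have mBmu : measurable_fun setT (fun z => (mu ^+ 2)%:E * (\1_B z)%:E).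
    by apply: measurable_funeM; exact: mI.
  have Xmu0 z : 0 <= (2 * mu)%:E * (X z)%:E by rewrite mule_ge0 // lee_fin.
  have Bmu0 z : 0 <= (mu ^+ 2)%:E * (\1_B z)%:E.
    by rewrite mule_ge0 // lee_fin sqr_ge0.
  rewrite -ge0_integralD //.
  apply: ge0_le_integral => //.
  - by move=> z _; rewrite adde_ge0.
  - exact: emeasurable_funD.
  - exact: emeasurable_funD.
  - move=> z _; rewrite WE -!EFinM -!EFinD lee_fin indicE.
    have [Bz|Bz] := pselect (B z); last first.
      rewrite memNset //= mulr0 add0r.
      by have := sqr_ge0 (X z - mu)%R; nra.
    rewrite mem_set //=.
    have -> : X z = 0%R.
      rewrite /X big_seq_cond big1 // => i /andP[si _].
      by rewrite indicE memNset //; exact: Bz.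
    by rewrite mulr1 mulr0 expr0n /= addr0 add0r.
have Pfin : P B \is a fin_num by rewrite fin_num_measure.
rewrite -(fineK Pfin) in key *.
rewrite -!EFinM -!EFinD !lee_fin in key *.
rewrite -/n -/mu -[(mu^-1)%R]mul1r ler_pdivlMr //.
have mup : (mu * (fine (P B) * mu) <= mu * 1)%R by nra.
by rewrite ler_pM2l in mup.
Qed.

End PairwiseIndependence.

(** * Coprime pairs *)

Section CoprimePairs.
Local Open Scope nat_scope.

Let multiples (L d : nat) := [seq i <- iota 1 L | d %| i].

Let size_multiples L d : 0 < d -> size (multiples L d) <= L %/ d.
Proof.
move=> d0; rewrite -[leqRHS](size_iota 1) -[leqRHS](size_map (muln d)).
apply: uniq_leq_size; first by rewrite filter_uniq // iota_uniq.
move=> i; rewrite mem_filter mem_iota add1n ltnS => /and3P[/dvdnP[k ->] k0 kL].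
apply/mapP; exists k; last by rewrite mulnC.
rewrite mem_iota add1n ltnS leq_divRL // kL andbT.
by move: k0; rewrite muln_gt0 => /andP[].
Qed.

(** The term 1/4 is kept exact and the others telescope through 1/d^2 <= 1/(d-1) - 1/d. The limit
    3/4 is below 1, so a union bound over all common divisors d >= 2, composite ones included, still
    leaves a positive proportion of coprime pairs. *)
Let sum_inv_sq (F : realFieldType) (n : nat) : (0 < n)%N ->
  (\sum_(2 <= d < n.+2) (d%:R ^+ 2)^-1 <= 3 / 4 - (n.+1%:R)^-1 :> F)%R.
Proof.
elim: n => // n IHn _; case: n IHn => [|n] IHn.
  by rewrite big_nat1; lra.
rewrite big_nat_recr //= -lerBrDr (le_trans (IHn _)) //.
set x : F := n.+2%:R; have x0 : (0 < x)%R by rewrite ltr0n.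
have -> : (n.+3%:R = x + 1 :> F)%R by rewrite /x -[n.+3]addn1 natrD.
rewrite -subr_ge0.
have -> : (3 / 4 - (x + 1)^-1 - ((x + 1) ^+ 2)^-1 - (3 / 4 - x^-1) =
    (x * (x + 1) ^+ 2)^-1)%R.
  by field; rewrite !gt_eqF // ltr_wpDl // ltW.
by rewrite invr_ge0 mulr_ge0 ?sqr_ge0 // ltW.
Qed.

Let sum_divn_sq (F : realFieldType) L : 0 < L ->
  4 * \sum_(2 <= d < L.+1) (L %/ d) ^ 2 <= 3 * L ^ 2.
Proof.
case: L => // -[_|L _]; first by rewrite big_geq.
rewrite -(ler_nat F) !natrM natr_sum.
have : (\sum_(2 <= d < L.+3) ((L.+2 %/ d) ^ 2)%N%:R <=
    L.+2%:R ^+ 2 * \sum_(2 <= d < L.+3) (d%:R ^+ 2)^-1 :> F)%R.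
  rewrite mulr_sumr big_seq [leRHS]big_seq; apply: ler_sum => d.
  rewrite mem_index_iota => /andP[d2 _].
  have d0 : (0 < d%:R :> F)%R by rewrite ltr0n (ltn_trans _ d2).
  rewrite (natrX F) -exprVn -exprMn ler_pXn2r ?nnegrE ?mulr_ge0 ?invr_ge0 //.
  by rewrite ler_pdivlMr // -natrM ler_nat leq_trunc_div.
have := sum_inv_sq F (isT : 0 < L.+1).
set S := (\sum_(2 <= d < L.+3) (d%:R ^+ 2)^-1 : F)%R.
set S' := (\sum_(2 <= d < L.+3) ((L.+2 %/ d) ^ 2)%N%:R : F)%R.
have : (0 <= L.+2%:R^-1 :> F)%R by rewrite invr_ge0.
have := sqr_ge0 (L.+2%:R : F)%R => a b c e.
have : (L.+2%:R ^+ 2 * S <= L.+2%:R ^+ 2 * (3 / 4))%R.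
  by apply: ler_wpM2l => //; apply: le_trans c _; rewrite gerBl.
lra.
Qed.

(* The lower bound on the first coordinate makes a definite quadratic form
   large on these pairs, while still leaving a positive proportion of them. *)
Definition coprime_pairs (M : nat) : seq (nat * nat) :=
  [seq p <- [seq (a, b) | a <- iota 1 (8 * M), b <- iota 1 (8 * M)]
     | coprime p.1 p.2 && (M < p.1)].

Lemma coprime_pairs_uniq M : uniq (coprime_pairs M).
Proof. by rewrite filter_uniq // allpairs_uniq ?iota_uniq // => -[? ?] [? ?]. Qed.

Lemma mem_coprime_pairs M p : p \in coprime_pairs M ->
  [/\ coprime p.1 p.2, M < p.1 <= 8 * M & 0 < p.2 <= 8 * M].
Proof.
rewrite mem_filter => /andP[/andP[cp Mp] /allpairsP[[a b] /= [aL bL pE]]].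
move: cp Mp aL bL; rewrite pE /= !mem_iota !add1n !ltnS.
by move=> -> -> /andP[_ ->] /andP[-> ->].
Qed.

(** With side L = 8 M there are 64 M^2 pairs. At most (3/4) L^2 = 48 M^2 have a common divisor, and
    at most M L = 8 M^2 have first coordinate <= M, which leaves 8 M^2. *)
Lemma size_coprime_pairs M : 8 * M ^ 2 <= size (coprime_pairs M).
Proof.
case: M => // M'; rewrite /coprime_pairs; move: M'.+1 (ltn0Sn M') => M M0.
move LE : (8 * M) => L; have L0 : 0 < L by rewrite -LE muln_gt0.
set all := [seq (a, b) | a <- iota 1 L, b <- iota 1 L].
have uall : uniq all by rewrite allpairs_uniq ?iota_uniq // => -[? ?] [? ?].
pose good (p : nat * nat) := coprime p.1 p.2 && (M < p.1).
have tot : size [seq p <- all | good p] + count (predC good) all = L * L.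
  by rewrite size_filter count_predC size_allpairs size_iota.
pose common d := [seq (a, b) | a <- multiples L d, b <- multiples L d].
have bad : count (predC good) all <=
    \sum_(2 <= d < L.+1) (L %/ d) ^ 2 + M * L.
  rewrite -size_filter.
  apply: (@leq_trans (size (flatten [seq common d | d <- index_iota 2 L.+1] ++
      [seq (a, b) | a <- iota 1 M, b <- iota 1 L]))).
    apply: uniq_leq_size; first exact: filter_uniq.
    move=> [a b]; rewrite mem_filter => /andP[/= ngood /allpairsP[[x y] /= [xL yL]]].
    move=> -[ax bx]; move: xL yL; rewrite -{}ax -{}bx => aL bL.
    rewrite mem_cat; move: ngood; rewrite negb_and -leqNgt => /orP[ncop|aM].
      apply/orP; left; apply/flatten_mapP; exists (gcdn a b).
        have /andP[a0 aL'] : 0 < a <= L by move: aL; rewrite mem_iota add1n ltnS.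
        move: ncop; rewrite mem_index_iota ltnS.
        rewrite (leq_trans (dvdn_leq a0 (dvdn_gcdl _ _)) aL') andbT /coprime.
        have : 0 < gcdn a b by rewrite gcdn_gt0 a0.
        by case: gcdn => [|[]].
      apply/allpairsP; exists (a, b); split => //; by
        rewrite mem_filter ?dvdn_gcdl ?dvdn_gcdr.
    apply/orP; right; apply/allpairsP; exists (a, b); split => //=.
    by move: aL; rewrite !mem_iota !add1n !ltnS aM andbT => /andP[].
  rewrite size_cat size_allpairs !size_iota leq_add2r size_flatten /shape -map_comp.
  rewrite sumnE big_map big_seq [leqRHS]big_seq; apply: leq_sum => d.
  rewrite mem_index_iota => /andP[d2 _] /=; rewrite size_allpairs -mulnn.
  by rewrite leq_mul // size_multiples // (ltn_trans _ d2).
have := sum_divn_sq rat L0; move: tot bad; rewrite -/all -/good;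
  set S := (\sum_(_ <= _ < _) _).
set c := count _ _; nia.
Qed.

(** Primitive vectors with nonnegative entries on the same line coincide, there being no sign
    ambiguity. Distinct pairs therefore have nonzero [ldet], as pairwise independence requires. *)
Lemma coprime_pairs_proportional M p q : p \in coprime_pairs M ->
  q \in coprime_pairs M -> p.1 * q.2 = p.2 * q.1 -> p = q.
Proof.
case: p q => [a b] [a' b'] /mem_coprime_pairs[/= cp _ _].
move=> /mem_coprime_pairs[/= cq _ _] e.
have ea : a = a'.
  apply/eqP; rewrite eqn_dvd; apply/andP; split.
    by rewrite -(Gauss_dvdr _ cp) -e dvdn_mulr.
  by rewrite -(Gauss_dvdl _ cq) e dvdn_mull.
have eb : b = b'.
  apply/eqP; rewrite eqn_dvd; apply/andP; split.
    have cp' : coprime b a by rewrite coprime_sym.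
    by rewrite -(Gauss_dvdr _ cp') e dvdn_mulr.
  have cq' : coprime b' a' by rewrite coprime_sym.
  by rewrite -(Gauss_dvdl _ cq') -e dvdn_mull.
by rewrite ea eb.
Qed.
End CoprimePairs.

(** * Parabolas over the coprime pairs *)

Lemma countable_bigcapT_measurable d (T : measurableType d) (U : countType)
    (F : U -> set T) : (forall i, measurable (F i)) -> measurable (\bigcap_i F i).
Proof.
move=> mF; rewrite -[X in measurable X]setCK setC_bigcap; apply: measurableC.
by apply: countable_bigcupT_measurable => // i; exact: measurableC.
Qed.

Section Parabola.
Context {R : realType}.
Local Notation MR := (measurableTypeR R).

Lemma nat_ge (x : R) : exists2 n : nat, (0 < n)%N & x <= n%:R.
Proof.
exists (Num.bound x).+1 => //.
have [x0|x0] := leP 0 x; last by rewrite (le_trans (ltW x0)).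
by rewrite (le_trans (ltW (archi_boundP x0))) // ler_nat.
Qed.

Definition box : set (MR * MR) := `[0, 1[%classic `*` `[0, 1[%classic.

Lemma measurable_box : measurable box.
Proof. exact: measurableX. Qed.

Lemma torus_box : torus box = 1%E.
Proof.
rewrite /torus /box product_measure1E //=.
rewrite /unif01 /mrestr setIid lebesgue_measure_itv /= lte_fin ltr01 oppr0 adde0.
by rewrite mule1.
Qed.

(* Integers m are bounded in [missed] because s is confined to [box], where
   [torus] is supported. *)
Definition missed (F : int -> int -> R -> R) (B xi d : R) : set (MR * MR) :=
  [set s | box s /\ forall l1 l2 m : int,
     `|l1%:~R| <= B -> `|l2%:~R| <= B -> `|m%:~R| <= B ->
     d <= `|F l1 l2 (m%:~R + ldot (l1, l2) s) - xi|].

Variables (alpha beta1 beta2 qa qb qc c0 : R).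
Hypotheses (alpha0 : 0 < alpha) (c00 : 0 < c0).
Let q (x y : R) := qa * x ^+ 2 + 2 * qb * x * y + qc * y ^+ 2.
Hypothesis q_ge : forall x y, c0 * x ^+ 2 <= q x y.
Variable F : int -> int -> R -> R.
Hypothesis FE : forall l1 l2 y, F l1 l2 y = q l1%:~R l2%:~R -
  alpha * (y - (beta1 * l1%:~R + beta2 * l2%:~R)) ^+ 2.

Lemma measurable_missed B xi d : measurable (missed F B xi d).
Proof.
rewrite (_ : missed _ _ _ _ = box `&` \bigcap_(n in
   [set n : int * int * int |
     [/\ `|n.1.1%:~R| <= B, `|n.1.2%:~R| <= B & `|n.2%:~R| <= B]])
   [set s | d <= `|F n.1.1 n.1.2 (n.2%:~R + ldot n.1 s) - xi|]); last first.
  apply/seteqP; split => s [bs Hs]; split=> //.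
    by move=> [[l1 l2] m] /= [? ? ?]; exact: Hs.
  by move=> l1 l2 m ? ? ?; apply: (Hs (l1, l2, m)).
apply: measurableI; first exact: measurable_box.
rewrite bigcap_mkcond; apply: countable_bigcapT_measurable => -[[l1 l2] m].
case: ifP => // _ /=.
have mf : measurable_fun setT
    (fun s : MR * MR => `|F l1 l2 (m%:~R + ldot (l1, l2) s) - xi|).
  apply: measurableT_comp => //; apply: measurable_funB => //.
  under eq_fun do rewrite FE.
  apply: measurable_funB => //; apply: measurable_funM => //.
  apply: measurable_funX; apply: measurable_funB => //; apply: measurable_funD => //.
  exact: measurable_ldot.
rewrite [X in measurable X](_ : _ = setT `&`
    (fun s : MR * MR => `|F l1 l2 (m%:~R + ldot (l1, l2) s) - xi|) @^-1` `[d, +oo[%classic).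
  exact: mf.
by rewrite setTI; apply/seteqP; split => s /=; rewrite in_itv /= andbT.
Qed.

Lemma q_le (x y b : R) : `|x| <= b -> `|y| <= b ->
  q x y <= (`|qa| + 2 * `|qb| + `|qc|) * b ^+ 2.
Proof.
move=> xb yb; have b0 : 0 <= b := le_trans (normr_ge0 _) xb.
rewrite (le_trans (ler_norm _)) // /q (le_trans (ler_normD _ _)) // [leRHS]mulrDl.
apply: lerD.
  rewrite (le_trans (ler_normD _ _)) // [leRHS]mulrDl; apply: lerD.
    by rewrite normrM normrX ler_wpM2l // lerXn2r // nnegrE.
  rewrite !normrM ger0_norm // -!mulrA expr2.
  by do 2 (apply: ler_wpM2l => //); apply: ler_pM.
by rewrite normrM normrX ler_wpM2l // lerXn2r // nnegrE.
Qed.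

(** At least 8 K^2 coprime pairs, each hit with probability of order d / K, give an expected number
    of hits of order at least K d, and Chebyshev's bound is its inverse. One [C] serves as size of
    the search box and as constant in the bound; its uniformity in K, xi and d is what the sum over
    the grid needs. *)
Lemma torus_missed : exists C : nat,
  forall (K : nat) (xi d : R), (0 < K)%N -> `|xi| <= K%:R ^+ 2 ->
    0 < d -> d <= K%:R ->
    (torus (missed F (C%:R * K%:R) xi d) <= (C%:R / (K%:R * d))%:E)%E.
Proof.
(* [C2] makes q >= c0 (C2 K)^2 >= K^2 >= |xi| on the pairs, so the roots are real; [C3] bounds the
   square root [z] by C3 K. The first four groups of terms in [C] bound the integer m, and alpha C3
   is for the final probability. *)
have [C2 C20 hC2] := nat_ge (c0^-1).
pose qq := `|qa| + 2 * `|qb| + `|qc|.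
have [C3 C30 hC3] := nat_ge (((64 * qq * C2%:R ^+ 2 + 1) + 1) / alpha).
have [C C0 hC] := nat_ge ((`|beta1| + `|beta2|) * 8 * C2%:R + C3%:R +
  16 * C2%:R + 1 + alpha * C3%:R).
exists C => K xi d K0 xiK d0 dK.
pose k : R := K%:R; rewrite -/k in xiK dK *.
have k1 : 1 <= k by rewrite /k -[1]/(1%:R) ler_nat.
have C2R : 1 <= C2%:R :> R by rewrite -[1]/(1%:R) ler_nat.
have C3R : 1 <= C3%:R :> R by rewrite -[1]/(1%:R) ler_nat.
have qq0 : 0 <= qq by rewrite /qq !addr_ge0 ?mulr_ge0.
pose M := (C2 * K)%N.
have ME : M%:R = C2%:R * k :> R by rewrite natrM.
have aC3 : 64 * qq * C2%:R ^+ 2 + 1 + 1 <= alpha * C3%:R.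
  by rewrite [leRHS]mulrC -ler_pdivrMr.
have aC31 : 1 <= alpha * C3%:R.
  by rewrite (le_trans _ aC3) // lerDr addr_ge0 ?mulr_ge0 ?sqr_ge0 //.
pose A (p : nat * nat) := (q p.1%:R p.2%:R - xi) / alpha.
pose z (p : nat * nat) := Num.sqrt (A p).
have A0 p : p \in coprime_pairs M -> 0 <= A p.
  move=> /mem_coprime_pairs[_ /andP[Mp _] _]; rewrite divr_ge0 ?(ltW alpha0) //.
  rewrite subr_ge0 (le_trans (ler_norm _)) // (le_trans xiK) //.
  apply: le_trans (q_ge _ _).
  have pM : C2%:R * k <= p.1%:R by rewrite -ME ler_nat ltnW.
  apply: (@le_trans _ _ (c0 * (C2%:R * k) ^+ 2)); last first.
    by rewrite ler_wpM2l ?(ltW c00) // lerXn2r // ?nnegrE // mulr_ge0 // /k.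
  rewrite exprMn mulrA ler_peMl ?sqr_ge0 //.
  have : 1 <= c0 * C2%:R by rewrite -ler_pdivrMl // mulr1.
  by move=> h; rewrite expr2 mulrA; nra.
have zle p : p \in coprime_pairs M -> z p <= C3%:R * k.
  move=> pM; have := A0 _ pM; move: pM => /mem_coprime_pairs[_ p1 p2] Ap0.
  have k0 : 0 <= C3%:R * k by rewrite mulr_ge0 // /k.
  rewrite /z -[leRHS]ger0_norm // -sqrtr_sqr ler_sqrt ?sqr_ge0 //.
  rewrite /A ler_pdivrMr //.
  have pb (n : nat) : (n <= 8 * M)%N -> `|n%:R : R| <= 8 * (C2%:R * k).
    by move=> nM; rewrite normr_nat -ME -[8]/(8%:R) -natrM ler_nat.
  have := q_le (pb _ (proj2 (andP p1))) (pb _ (proj2 (andP p2))); rewrite -/qq.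
  have := le_trans (ler_norm (- xi)) _; rewrite normrN => /(_ _ xiK).
  have kk : 0 <= k ^+ 2 := sqr_ge0 _.
  have : (64 * qq * C2%:R ^+ 2 + 1) * k ^+ 2 <= alpha * C3%:R * k ^+ 2.
    by apply: ler_wpM2r => //; apply: le_trans aC3; rewrite lerDl.
  have : alpha * C3%:R * k ^+ 2 * 1 <= alpha * C3%:R * k ^+ 2 * C3%:R.
    by apply: ler_wpM2l => //; rewrite !mulr_ge0 // ltW.
  move: (q _ _) => Q.
  have -> : qq * (8 * (C2%:R * k)) ^+ 2 = 64 * qq * C2%:R ^+ 2 * k ^+ 2 by ring.
  have -> : (C3%:R * k) ^+ 2 * alpha = alpha * C3%:R * k ^+ 2 * C3%:R by ring.
  rewrite mulrDl mul1r mulr1; lra.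
(* Twice the bound for alpha (2 z + t): an overshoot t < lam = d / D then changes the value by at
   most d / 2, hence strictly less than d. *)
pose D := 2 * alpha * (2 * C3%:R * k + 1).
have D0 : 0 < D.
  by rewrite !mulr_gt0 // ltr_wpDl // !mulr_ge0 // /k.
pose lam := d / D.
have lam0 : 0 < lam by rewrite divr_gt0.
have lamD : lam * D = d by rewrite /lam divfK // gt_eqF.
have lam1 : lam <= 1.
  rewrite /lam ler_pdivrMr // mul1r (le_trans dK) // /D.
  have -> : 2 * alpha * (2 * C3%:R * k + 1) = 4 * (alpha * C3%:R) * k + 2 * alpha
    by ring.
  have : 1 * k <= alpha * C3%:R * k by rewrite ler_wpM2r // /k.
  by have := alpha0; lra.
pose c (p : nat * nat) := beta1 * p.1%:R + beta2 * p.2%:R + z p.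
pose Z (p : nat * nat) : int * int := (Posz p.1, Posz p.2).
pose E (p : nat * nat) := hits (Z p) (c p) lam.
have s0 : (0 < size (coprime_pairs M))%N.
  by apply: leq_trans (size_coprime_pairs M); rewrite muln_gt0 expn_gt0 muln_gt0 C20 K0.
have miss := @pairwise_independent_miss _ _ R torus _ (coprime_pairs M) E lam
  (coprime_pairs_uniq M) (fun p => measurable_hits _ _ _) lam0 s0.
have lam01 : 0 <= lam <= 1 by rewrite ltW.
apply: (@le_trans _ _ (torus [set s | forall p, p \in coprime_pairs M -> ~ E p s])).
  apply: le_measure; rewrite ?inE; first exact: measurable_missed.
    rewrite (_ : mkset _ = \bigcap_p (if p \in coprime_pairs M then ~` E p else setT)).
      apply: countable_bigcapT_measurable => p; case: ifP => // _.
      by apply: measurableC; exact: measurable_hits.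
    apply/seteqP; split => s /= Hs p; first by move=> _; case: ifPn => // /Hs.
    by move=> pM; have := Hs p I; rewrite pM.
  move=> s [bs Hs] p pM Eps.
  have := bs; rewrite /box /= !in_itv /= => -[/andP[s10 s11] /andP[s20 s21]].
  (* With this integer, m + l.s exceeds the root [c p] by exactly the fractional part [t]. *)
  pose m := - Num.floor (ldot (Z p) s - c p).
  have [_ /andP[p1' p1] /andP[p2' p2]] := mem_coprime_pairs pM.
  have p1R : p.1%:R <= 8 * (C2%:R * k) by rewrite -ME -[8]/(8%:R) -natrM ler_nat.
  have p2R : p.2%:R <= 8 * (C2%:R * k) by rewrite -ME -[8]/(8%:R) -natrM ler_nat.
  pose t := frac (ldot (Z p) s - c p).
  have t0 : 0 <= t := frac_ge0 _.
  have tl : t < lam := Eps.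
  have tE : t = ldot (Z p) s - c p + m%:~R by rewrite /m rmorphN.
  have zk := zle _ pM.
  have z0 : 0 <= z p := sqrtr_ge0 _.
  have CK : C%:R * k >= ((`|beta1| + `|beta2|) * 8 * C2%:R + C3%:R +
     16 * C2%:R + 1 + alpha * C3%:R) * k by rewrite ler_wpM2r // /k.
  have c2k : 0 <= C2%:R * k by rewrite mulr_ge0 // /k.
  have bb1 : `|beta1 * p.1%:R| <= `|beta1| * (8 * (C2%:R * k)).
    by rewrite normrM normr_nat ler_wpM2l.
  have bb2 : `|beta2 * p.2%:R| <= `|beta2| * (8 * (C2%:R * k)).
    by rewrite normrM normr_nat ler_wpM2l.
  have bk1 : 0 <= `|beta1| * (8 * (C2%:R * k)) by rewrite !mulr_ge0 // /k.
  have bk2 : 0 <= `|beta2| * (8 * (C2%:R * k)) by rewrite !mulr_ge0 // /k.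
  have ak : 0 <= alpha * C3%:R * k by rewrite !mulr_ge0 ?(ltW alpha0) // /k.
  have C3k : 0 <= C3%:R * k by rewrite mulr_ge0 // /k.
  have s1p : 0 <= p.1%:R * s.1 <= 8 * (C2%:R * k).
    by rewrite mulr_ge0 //= -[leRHS]mulr1 ler_pM // ltW.
  have s2p : 0 <= p.2%:R * s.2 <= 8 * (C2%:R * k).
    by rewrite mulr_ge0 //= -[leRHS]mulr1 ler_pM // ltW.
  have /andP[s1a s1b] := s1p; have /andP[s2a s2b] := s2p.
  move: CK; have -> : ((`|beta1| + `|beta2|) * 8 * C2%:R + C3%:R +
     16 * C2%:R + 1 + alpha * C3%:R) * k = `|beta1| * (8 * (C2%:R * k)) +
     `|beta2| * (8 * (C2%:R * k)) + C3%:R * k + 16 * (C2%:R * k) + k +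
     alpha * C3%:R * k by ring.
  move=> CK.
  have := Hs p.1 p.2 m.
  rewrite -!pmulrn !normr_nat.
  have lE : ldot (Z p) s = p.1%:R * s.1 + p.2%:R * s.2 by [].
  have mE : m%:~R = t + beta1 * p.1%:R + beta2 * p.2%:R + z p - (p.1%:R * s.1 + p.2%:R
    * s.2).
    by rewrite tE lE /c; ring.
  have h1 : p.1%:R <= C%:R * k by clear -p1R CK bk1 bk2 ak C3k c2k k1; lra.
  have h2 : p.2%:R <= C%:R * k by clear -p2R CK bk1 bk2 ak C3k c2k k1; lra.
  have h3 : `|m%:~R : R| <= C%:R * k.
    have tle1 : t <= 1 by rewrite ltW // (lt_le_trans tl).
    move: bb1 bb2; rewrite mE !ler_norml => /andP[e1 e2] /andP[e3 e4].
    clear -CK bk1 bk2 ak C3k c2k k1 t0 tle1 z0 zk s1a s1b s2a s2b e1 e2 e3 e4.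
    by apply/andP; split; lra.
  move=> /(_ h1 h2 h3); apply/negP; rewrite -ltNge.
  have -> : F p.1 p.2 (m%:~R + ldot (Z p) s) - xi = - (alpha * (t * (2 * z p + t))).
    rewrite FE mE lE -!pmulrn.
    have : alpha * z p ^+ 2 = q p.1%:R p.2%:R - xi.
      rewrite /z sqr_sqrtr; last exact: A0.
      by rewrite /A mulrC divfK // gt_eqF.
    move: (q _ _) => Q QE; have -> : Q = alpha * z p ^+ 2 + xi by rewrite QE subrK.
    ring.
  have tz : 0 <= t * (2 * z p + t) by rewrite mulr_ge0 // addr_ge0 // mulr_ge0.
  rewrite normrN ger0_norm; last by rewrite mulr_ge0 // ltW.
  have : t * (2 * z p + t) <= lam * (2 * C3%:R * k + 1).
    by apply: ler_pM => //; [rewrite addr_ge0 // mulr_ge0|exact: ltW|lra].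
  rewrite -(ler_pM2l alpha0) => /le_lt_trans; apply.
  by rewrite -lamD /D; have := d0; rewrite -lamD /D; lra.
apply: (le_trans (miss _ _)).
- move=> p pM; apply: torus_hits => //.
  have [_ /andP[p1' _] _] := mem_coprime_pairs pM.
  by apply/eqP => -[e _]; move: p1'; rewrite e.
- move=> p p' pM p'M pp'; rewrite expr2; apply: torus_hitsI; rewrite // /ldet /=.
  apply: contra pp'; rewrite subr_eq0 -!PoszM eqz_nat => /eqP e.
  by apply/eqP; exact: (coprime_pairs_proportional pM).
have k0 : 0 < k := lt_le_trans ltr01 k1.
have szp : (size (coprime_pairs M))%:R * lam \is Num.pos.
  by rewrite posrE mulr_gt0 // ltr0n.
have kdp : k * d / C%:R \is Num.pos.
  by rewrite posrE divr_gt0 ?mulr_gt0 // ltr0n.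
rewrite lee_fin -[leRHS]invf_div lef_pV2 //.
have szR : 8 * k ^+ 2 <= (size (coprime_pairs M))%:R.
  rewrite /k -natrX -[8]/(8%:R) -natrM ler_nat.
  apply: leq_trans (size_coprime_pairs M).
  by rewrite leq_pmul2l // leq_exp2r // leq_pmull.
apply: (@le_trans _ _ (8 * k ^+ 2 * lam)); last by rewrite ler_wpM2r // ltW.
rewrite ler_pdivrMr ?ltr0n // -(ler_pM2r D0).
have -> : 8 * k ^+ 2 * lam * C%:R * D = 8 * k ^+ 2 * C%:R * (lam * D) by ring.
rewrite lamD.
have -> : k * d * D = 2 * (alpha * (2 * C3%:R * k + 1)) * k * d by rewrite /D; ring.
have CaC3 : alpha * C3%:R <= C%:R.
  by apply: le_trans hC; rewrite lerDr !addr_ge0 ?mulr_ge0.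
have : alpha * (2 * C3%:R * k + 1) <= 3 * C%:R * k.
  have : alpha * C3%:R * k <= C%:R * k by rewrite ler_wpM2r // /k.
  have : alpha * 1 <= alpha * (C3%:R * k).
    by rewrite ler_pM2l // mulr_ege1.
  by rewrite !mulrA; lra.
have kd0 : 0 <= k * d by rewrite mulr_ge0 // ltW.
move=> /(ler_wpM2r kd0).
have : 0 <= C%:R * k * (k * d) by rewrite !mulr_ge0 // ltW.
by rewrite expr2 !mulrA; lra.
Qed.

End Parabola.

(** * Forms of signature (2,1) *)

Section Lorentz.
Context {R : realType}.
Implicit Types (H : 'M[R]_3).

Definition row3 (x y z : R) : 'rV[R]_3 :=
  \row_j (if j == 0 then x else if j == 1 then y else z).

Lemma det_mx33 (K : comNzRingType) (H : 'M[K]_3) : \det H =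
  H 0 0 * (H 1 1 * H 2 2 - H 1 2 * H 2 1)
  - H 0 1 * (H 1 0 * H 2 2 - H 1 2 * H 2 0)
  + H 0 2 * (H 1 0 * H 2 1 - H 1 1 * H 2 0).
Proof.
rewrite (expand_det_row _ 0) !big_ord_recl big_ord0 /cofactor.
rewrite !(expand_det_row _ 0) !big_ord_recl !big_ord0 /cofactor !det_mx11 !mxE /=.
pose h (i j : nat) := H (inord i) (inord j).
have Hh i j : H i j = h i j by rewrite /h !inord_val.
by rewrite !Hh /= /bump /= !(expr0, expr1, addn0, add0n, addn1); ring.
Qed.

Lemma row3_mulmx x y z H j : (row3 x y z *m H) 0 j = x * H 0 j + y * H 1 j + z * H 2 j.
Proof.
rewrite mxE !big_ord_recl big_ord0 !mxE /= addr0 addrA.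
by congr (_ * H _ _ + _ * H _ _ + _ * H _ _); apply: val_inj.
Qed.


(** * The form induced modulo a negative vector *)

Section Signature.
Variables a0 a1 a2 b0 b1 b2 c0 c1 c2 : R.
Let al := c2 ^+ 2 - c0 ^+ 2 - c1 ^+ 2.
Let Ba := a0 * c0 + a1 * c1 - a2 * c2.
Let Bb := b0 * c0 + b1 * c1 - b2 * c2.
Let qa := a0 ^+ 2 + a1 ^+ 2 - a2 ^+ 2 + Ba ^+ 2 / al.
Let qb := a0 * b0 + a1 * b1 - a2 * b2 + Ba * Bb / al.
Let qc := b0 ^+ 2 + b1 ^+ 2 - b2 ^+ 2 + Bb ^+ 2 / al.
Let q (x y : R) := qa * x ^+ 2 + 2 * qb * x * y + qc * y ^+ 2.

(** Here al = -Q0(c), and Ba, Bb are the pairings of a and b with c. The coefficients of [q] are the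
    Gram entries of the projections a + (Ba / al) c and b + (Bb / al) c onto the orthogonal
    complement of c. *)
Lemma complete_square (x y t : R) : al != 0 ->
  (x * a0 + y * b0 + t * c0) ^+ 2 + (x * a1 + y * b1 + t * c1) ^+ 2
    - (x * a2 + y * b2 + t * c2) ^+ 2 =
  q x y - al * (t - (Ba / al * x + Bb / al * y)) ^+ 2.
Proof. by rewrite /q /qa /qb /qc /Ba /Bb /al => al0; field. Qed.

(** For v = x a + y b, [p] and [r] are the first two coordinates of c2 v - v2 c, a multiple of v
    modulo c whose last coordinate is 0. *)
Let p x y := (x * a0 + y * b0) * c2 - (x * a2 + y * b2) * c0.
Let r x y := (x * a1 + y * b1) * c2 - (x * a2 + y * b2) * c1.
Let det := a0 * (b1 * c2 - b2 * c1) - a1 * (b0 * c2 - b2 * c0)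
   + a2 * (b0 * c1 - b1 * c0).

(* Reversed Cauchy-Schwarz: q is the form induced on the quotient by a
   negative vector c, and c2^2 al q = c2^2 (p^2 + r^2) - (p c1 - r c0)^2. *)
Lemma quotient_form_ge : 0 < al -> det != 0 ->
  exists2 e : R, 0 < e & forall x y : R, e * x ^+ 2 <= q x y.
Proof.
move=> al0 det0.
have c20 : 0 < c2 ^+ 2.
  by have := al0; rewrite /al; have := sqr_ge0 c0; have := sqr_ge0 c1; lra.
have q_ge x y : p x y ^+ 2 + r x y ^+ 2 <= c2 ^+ 2 * q x y.
  rewrite -(ler_pM2l al0).
  have -> : al * (c2 ^+ 2 * q x y) =
      c2 ^+ 2 * (p x y ^+ 2 + r x y ^+ 2) - (p x y * c1 - r x y * c0) ^+ 2.
    have al1 : al != 0 by rewrite gt_eqF.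
    by move: al1; rewrite /q /qa /qb /qc /p /r /Ba /Bb /al => al1; field.
  rewrite /al -subr_ge0.
  set P := p x y; set Q := r x y.
  rewrite [leRHS](_ : _ = (P * c0 + Q * c1) ^+ 2) ?sqr_ge0 //; ring.
(* Cramer's rule recovers x: p(x,y) r(0,1) - r(x,y) p(0,1) = +-c2 det x, and Cauchy-Schwarz bounds
   its square by (p^2 + r^2)(p(0,1)^2 + r(0,1)^2). The added 1 keeps the denominator positive. *)
pose e := det ^+ 2 / (p 0 1 ^+ 2 + r 0 1 ^+ 2 + 1).
have S0 : 0 < p 0 1 ^+ 2 + r 0 1 ^+ 2 + 1.
  by rewrite ltr_wpDl // addr_ge0 ?sqr_ge0.
exists e => [|x y].
  by rewrite /e divr_gt0 // lt_neqAle sqr_ge0 andbT eq_sym sqrf_eq0.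
rewrite /e mulrAC ler_pdivrMr //.
have q0 : 0 <= q x y.
  rewrite -(ler_pM2l c20) mulr0 (le_trans _ (q_ge x y)) //.
  by rewrite addr_ge0 ?sqr_ge0.
apply: (@le_trans _ _ (q x y * (p 0 1 ^+ 2 + r 0 1 ^+ 2))); last first.
  by rewrite ler_wpM2l // lerDl.
rewrite -(ler_pM2l c20) [leRHS]mulrA.
apply: le_trans (ler_wpM2r _ (q_ge x y)); last by rewrite addr_ge0 ?sqr_ge0.
have -> : c2 ^+ 2 * (det ^+ 2 * x ^+ 2) = (p x y * r 0 1 - r x y * p 0 1) ^+ 2.
  by rewrite /det /p /r; ring.
rewrite -subr_ge0.
rewrite [leRHS](_ : _ = (p x y * p 0 1 + r x y * r 0 1) ^+ 2) ?sqr_ge0 //; ring.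
Qed.

End Signature.
End Lorentz.

(** * Borel-Cantelli along dyadic scales *)

Section BorelCantelli.
Context {R : realType}.
Local Notation MR := (measurableTypeR R).

(** The indices 0 and 1 contribute 2; each dyadic block has 2^j terms of size at most 2^-j. *)
Lemma sum_inv_maxn (j : nat) :
  \sum_(u < (2 ^ j).+1) (maxn u 1)%:R^-1 <= 2 + j%:R :> R.
Proof.
rewrite -(big_mkord xpredT (fun u => (maxn u 1)%:R^-1 : R)).
elim: j => [|j IH]; first by rewrite !big_nat_recr //= big_geq // invr1; lra.
have le2 : ((2 ^ j).+1 <= (2 ^ j.+1).+1)%N by rewrite ltnS leq_exp2l.
rewrite (@big_cat_nat _ _ _ (2 ^ j).+1) //=.
rewrite -[j.+1%:R]natr1 addrA lerD //.
apply: (@le_trans _ _ (\sum_((2 ^ j).+1 <= u < (2 ^ j.+1).+1) (2 ^ j)%:R^-1)).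
  rewrite big_nat [leRHS]big_nat; apply: ler_sum => u /andP[u1 _].
  rewrite lef_pV2 ?posrE ?ltr0n ?expn_gt0 ?leq_max ?orbT // ler_nat.
  by rewrite leq_max (ltnW u1).
rewrite big_const_nat iter_addr_0 subSS expnS mul2n -addnn addnK.
by rewrite -[leLHS]mulr_natl mulfV // pnatr_eq0 -lt0n expn_gt0.
Qed.

Lemma sum_geometric_le (y : R) n : 0 <= y -> y < 1 -> \sum_(i < n) y ^+ i <= (1 - y)^-1.
Proof.
move=> y0 y1; have y10 : 0 < 1 - y by rewrite subr_gt0.
have := subrX1 y n; rewrite -opprB -[_ - 1]opprB mulNr => /oppr_inj e.
rewrite -(ler_pM2l y10) -e mulfV ?gt_eqF // lerBlDr lerDl.
exact: exprn_ge0.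
Qed.

Lemma natmul_exp_le (y : R) n : 0 <= y -> y < 1 -> n.+1%:R * y ^+ n <= (1 - y)^-1.
Proof.
move=> y0 y1; apply: le_trans (sum_geometric_le n.+1 y0 y1).
rewrite mulr_natl -[n.+1 in leLHS]card_ord -sumr_const; apply: ler_sum => i _.
by rewrite ler_wiXn2l // ?ltW // -ltnS.
Qed.

Local Open Scope ereal_scope.

(** Half of the decay, y = sqrt rho, absorbs the linear factor; the other half is summed as a
    geometric series. *)
Lemma nneseries_exp_lty (rho A : R) (a : nat -> \bar R) :
  (0 <= rho < 1)%R -> (0 <= A)%R -> (forall i, 0 <= a i) ->
  (forall i, a i <= (A * i.+1%:R * rho ^+ i)%:E) ->
  \sum_(i <oo) a i < +oo.
Proof.
move=> /andP[rho0 rho1] A0 a0 aA; pose y := Num.sqrt rho.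
have y0 : (0 <= y)%R := sqrtr_ge0 _.
have yy : (y ^+ 2 = rho)%R by rewrite sqr_sqrtr.
have y1 : (y < 1)%R by rewrite -(expr_lt1 (n := 2)) // yy.
have iy : (0 <= (1 - y)^-1)%R by rewrite invr_ge0 subr_ge0 ltW.
apply: (@le_lt_trans _ _ (A * (1 - y)^-1 * (1 - y)^-1)%:E); last exact: ltry.
apply: lime_le; first by apply: is_cvg_nneseries.
apply: nearW => n; apply: (@le_trans _ _
  (\sum_(0 <= i < n) (A * (1 - y)^-1 * y ^+ i)%:E)).
  apply: lee_sum => i _; apply: le_trans (aA i) _; rewrite lee_fin -yy -exprM mulnC.
  rewrite exprM expr2 !mulrA ler_wpM2r ?exprn_ge0 // -!mulrA ler_wpM2l //.
  exact: natmul_exp_le.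
rewrite sumEFin lee_fin -mulr_sumr ler_wpM2l ?mulr_ge0 // big_mkord.
exact: sum_geometric_le.
Qed.

Local Close Scope ereal_scope.

(* With K = 2 ^ i and kappa ^ i = K^-eta, the hypotheses on N and delta only ask
   to approximate xi to within max (sqrt (|xi| K^-eta), K^-eta), up to a
   constant. This is also the gap between consecutive grid points +-u^2 K^-eta. *)
Definition grid (kappa : R) (i u : nat) (sg : bool) : R :=
  (-1) ^+ sg * (u%:R ^+ 2 * kappa ^+ i).

Definition precision (kappa : R) (i u : nat) : R := (maxn u 1)%:R * kappa ^+ i.

Variables (F : int -> int -> R -> R) (C : nat) (kappa : R).
Hypotheses (kappa_gt : 2^-1 < kappa) (kappa_lt1 : kappa < 1).
Hypothesis mF : forall B xi d, measurable (missed F B xi d).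
Hypothesis missF : forall (K : nat) (xi d : R), (0 < K)%N ->
    `|xi| <= K%:R ^+ 2 -> 0 < d -> d <= K%:R ->
    (torus (missed F (C%:R * K%:R) xi d) <= (C%:R / (K%:R * d))%:E)%E.

(** The test restricts to targets of modulus at most K^2 with K = 2^i, the range covered by
    [missF]. *)
Let bad1 i u sg : set (MR * MR) :=
  if u%:R ^+ 2 * kappa ^+ i <= 4 ^+ i then
    missed F (C%:R * (2 ^ i)%:R) (grid kappa i u sg) (precision kappa i u) else set0.

(** The cutoff 4^i loses no grid point: since kappa > 1/2, u^2 kappa^i <= 4^i forces u^2 <= 8^i.
    Being a power of 2, it makes the harmonic sum linear in i. *)
Let bad i := \big[setU/set0]_(u < (2 ^ (2 * i)).+1) (bad1 i u false `|` bad1 i u true).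

Let k0 : 0 < kappa. Proof. by apply: lt_trans kappa_gt; rewrite invr_gt0. Qed.
Let ki0 i : 0 < kappa ^+ i. Proof. exact: exprn_gt0. Qed.
Let ki1 i : kappa ^+ i <= 1. Proof. by apply: exprn_ile1; rewrite ltW. Qed.

Let mbad1 i u sg : measurable (bad1 i u sg).
Proof. by rewrite /bad1; case: ifP => // _; exact: mF. Qed.

Let mbad i : measurable (bad i).
Proof. by apply: bigsetU_measurable => u _; apply: measurableU. Qed.

Let bad1_le i u sg :
  (torus (bad1 i u sg) <= (C%:R * ((2 * kappa)^-1) ^+ i * (maxn u 1)%:R^-1)%:E)%E.
Proof.
rewrite /bad1; case: ifPn => [ui|_]; last first.
  rewrite measure0 lee_fin !mulr_ge0 ?exprn_ge0 ?invr_ge0 //.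
  by rewrite mulr_ge0 // ltW.
have mx0 : 0 < (maxn u 1)%:R :> R by rewrite ltr0n leq_max orbT.
have p0 : 0 < precision kappa i u by rewrite mulr_gt0.
have four : 4 ^+ i = (2 ^+ i) ^+ 2 :> R.
  by rewrite -exprM mulnC exprM; congr (_ ^+ i); rewrite -natrX.
apply: (le_trans (missF _ _ _ _)) => //.
- by rewrite expn_gt0.
- rewrite /grid normrM normr_sign mul1r ger0_norm ?mulr_ge0 ?sqr_ge0 ?(ltW (ki0 i)) //.
  by rewrite natrX -four.
(* For u >= 1, (u kappa^i)^2 <= u^2 kappa^i <= 4^i because kappa^i <= 1. *)
- rewrite natrX /precision /maxn; case: ifP => _.
    by rewrite mul1r (le_trans (ki1 i)) // exprn_ege1 // -[1]/(1%:R) ler_nat.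
  rewrite -(@ler_pXn2r _ 2) ?nnegrE ?mulr_ge0 ?(ltW (ki0 i)) ?exprn_ge0 //.
  rewrite -four (le_trans _ ui) // exprMn ler_wpM2l ?sqr_ge0 //.
  by rewrite expr2 ler_piMl ?(ltW (ki0 i)) ?ki1.
rewrite lee_fin natrX /precision exprVn exprMn le_eqVlt; apply/orP; left.
apply/eqP; have := ki0 i; have : 0 < 2 ^+ i :> R by rewrite exprn_gt0.
by move=> e2 ek; field; rewrite !gt_eqF.
Qed.

Let bad_le i :
  (torus (bad i) <= (4 * C%:R * i.+1%:R * ((2 * kappa)^-1) ^+ i)%:E)%E.
Proof.
apply: (le_trans (@Boole_inequality _ _ _ torus
  (fun u => bad1 i u false `|` bad1 i u true) _ _)).
  by move=> u _; exact: measurableU.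
set r := _ ^+ i.
have r0 : 0 <= r by rewrite exprn_ge0 // invr_ge0 mulr_ge0 // ltW.
apply: (@le_trans _ _ (\sum_(u < (2 ^ (2 * i)).+1)
    (2 * C%:R * r * (maxn u 1)%:R^-1)%:E)%E).
  apply: lee_sum => u _.
  apply: (le_trans (measureU2 torus _ _)) => //.
  have -> : 2 * C%:R * r * (maxn u 1)%:R^-1 =
    C%:R * r * (maxn u 1)%:R^-1 + C%:R * r * (maxn u 1)%:R^-1 by ring.
  by rewrite EFinD; apply: leeD; exact: bad1_le.
rewrite sumEFin lee_fin -mulr_sumr.
have -> : 4 * C%:R * i.+1%:R * r = 2 * C%:R * r * (2 + (2 * i)%:R).
  by rewrite -natr1 natrM; ring.
by rewrite ler_wpM2l ?sum_inv_maxn // !mulr_ge0.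
Qed.

Lemma ae_eventually_hit : torus.-negligible
  [set s | box s /\ ~ exists I : nat, forall i, (I <= i)%N -> forall u sg,
     u%:R ^+ 2 * kappa ^+ i <= 4 ^+ i ->
     exists l1 l2 m : int, [/\ `|l1%:~R| <= C%:R * (2 ^ i)%:R :> R,
       `|l2%:~R| <= C%:R * (2 ^ i)%:R :> R, `|m%:~R| <= C%:R * (2 ^ i)%:R :> R &
       `|F l1 l2 (m%:~R + ldot (l1, l2) s) - grid kappa i u sg| < precision kappa i u]].
Proof.
exists (lim_sup_set bad); split.
- apply: bigcap_measurable => // n _; exact: bigcup_measurable.
- apply: lim_sup_set_cvg0 => //.
  apply: (@nneseries_exp_lty ((2 * kappa)^-1) (4 * C%:R)) => //.
  apply/andP; split; first by rewrite invr_ge0 mulr_ge0 // ltW.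
  by rewrite invf_lt1 ?mulr_gt0 // mulrC -ltr_pdivrMr // mul1r.
move=> s [bs]; apply: contra_notP => /= nlim.
have [I HI] : exists I, forall i, (I <= i)%N -> ~ bad i s.
  apply: contra_notP nlim => nI n _.
  apply: contrapT => nn; apply: nI; exists n => i ni bi; apply: nn.
  by exists i.
exists I => i Ii u sg ui; apply: contrapT => nhit.
apply: (HI i Ii); rewrite /bad.
have uu : (u < (2 ^ (2 * i)).+1)%N.
  rewrite ltnS -(leq_exp2r _ _ (ltn0Sn 1)) -(ler_nat R) natrX.
  have i1 : 1 <= 2 ^+ i * kappa ^+ i.
    by rewrite -exprMn exprn_ege1 // mulrC -ler_pdivrMr // mul1r ltW.
  apply: (@le_trans _ _ (u%:R ^+ 2 * (2 ^+ i * kappa ^+ i))).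
    by rewrite ler_peMr // sqr_ge0.
  rewrite mulrCA; apply: (@le_trans _ _ (2 ^+ i * 4 ^+ i)).
    by rewrite ler_wpM2l ?exprn_ge0.
  rewrite -exprMn -expnM natrX mulnC mulnA exprM -natrX lerXn2r ?nnegrE //.
  by rewrite -natrM ler_nat.
rewrite -(bigcup_mkord _ (fun u => bad1 i u false `|` bad1 i u true)).
exists u => //=.
suff : bad1 i u sg s by case: (sg); [right|left].
rewrite /bad1 ui; split => // l1 l2 m h1 h2 h3; rewrite leNgt; apply/negP => h.
by apply: nhit; exists l1, l2, m.
Qed.

End BorelCantelli.

(** * Measure theory on SL_3(R) *)

Section SL3Measure.
Context {R : realType}.
Local Notation MR := (measurableTypeR R).
Local Notation G3 := (borelSL3 R).

Lemma continuous_entry (i j : 'I_3) : continuous (fun g : SL3 R => \val g i j).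
Proof.
move=> g; apply: (@continuous_comp _ _ _ (fun g : SL3 R => \val g)
  (fun M : 'M[R]_3 => M i j)).
  exact: (@initial_continuous _ _ (fun g : SL3 R => \val g)).
exact: coord_continuous.
Qed.

Lemma continuous_measurable_borel (T : ptopologicalType) (f : T -> R) : continuous f ->
  measurable_fun setT (f : g_sigma_algebraType (@open T) -> R).
Proof.
move=> cf; apply: (measurability _ (RGenOpens.measurableE R)).
move=> _ [_ [a [b ->] <-]]; rewrite setTI; apply: sub_sigma_algebra.
by move/continuousP : cf; apply; exact: interval_open.
Qed.

Lemma measurable_entry (i j : 'I_3) :
  measurable_fun setT (fun g : G3 => \val (g : SL3 R) i j : R).
Proof.
apply: (@continuous_measurable_borel (SL3 R)); exact: continuous_entry.
Qed.

Definition bounded_SL3 (n : nat) : set G3 :=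
  [set g : SL3 R | forall i j : 'I_3, `|\val g i j| <= n%:R].

Lemma measurable_bounded_SL3 n : measurable (bounded_SL3 n).
Proof.
rewrite (_ : bounded_SL3 n = \bigcap_(ij : 'I_3 * 'I_3)
   (setT `&` (fun g : G3 => \val (g : SL3 R) ij.1 ij.2 : R)
      @^-1` `[- n%:R, n%:R]%classic)).
  by apply: countable_bigcapT_measurable => ij; apply: measurable_entry.
apply/seteqP; split => g /= Hg.
  by move=> [i j] _ /=; split => //; rewrite in_itv /= -ler_norml.
by move=> i j; have [_] := Hg (i, j) I; rewrite /= in_itv /= -ler_norml.
Qed.

(** An ultrafilter on bounded matrices converges entrywise, and the limit has determinant 1 since
    the determinant is a polynomial in the entries. Convergence in the induced topology is entrywise
    convergence. *)
Lemma compact_bounded_SL3 n : compact (bounded_SL3 n : set (SL3 R)).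
Proof.
rewrite compact_ultra => F UF Fn.
have conv i j : exists a : R, (fun g : SL3 R => \val g i j) @ F --> a.
  have FF : ProperFilter F := @ultra_proper _ F UF.
  have [|a [_ ca]] := @segment_compact R (- n%:R) n%:R
      ((fun g : SL3 R => \val g i j) @ F) _.
    have : F [set g : SL3 R | (\val g i j \in `[- n%:R, n%:R])%R]; last by [].
    by apply: filterS Fn => g /(_ i j); rewrite /= in_itv /= -ler_norml.
  exists a => V Va /=.
  have [//|FnV] := in_ultra_setVsetC ((fun g : SL3 R => \val g i j) @^-1` V) UF.
  by have [x [nVx Vx]] := ca (~` V) V FnV Va.
have [a Ha] : exists a : 'M[R]_3, forall i j,
    (fun g : SL3 R => \val g i j) @ F --> a i j.
  have [f Hf] := choice (fun ij : 'I_3 * 'I_3 => conv ij.1 ij.2).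
  by exists (\matrix_(i, j) f (i, j)) => i j; rewrite mxE; exact: (Hf (i, j)).
have FF : ProperFilter F := @ultra_proper _ F UF.
have da : \det a = 1.
  have : (fun g : SL3 R => \det (\val g)) @ F --> \det a.
    under eq_fun do rewrite det_mx33.
    rewrite det_mx33.
    by do ?[exact: Ha|apply: cvgB|apply: cvgD|apply: cvgM].
  under eq_fun do rewrite det_SL3.
  move=> cd; apply/esym; apply: (cvg_unique _ _ cd) => //; exact: cvg_cst.
exists (SL3_of da); split.
  move=> i j /=.
  have cn : (fun g : SL3 R => `|\val g i j|) @ F --> `|a i j|
    by apply: cvg_norm; exact: Ha.
  by apply: (cvgr_to_le cn); apply: (filterS _ Fn) => g Hg; exact: Hg.
move=> U [_ [[W oW <-] /= Wx sWU]]; apply: (filterS sWU).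
move: oW; rewrite openE => /(_ _ Wx) [P Pn PW].
apply: (@filterS _ F _ (\bigcap_(ij in [set: 'I_3 * 'I_3])
    (fun g : SL3 R => \val g ij.1 ij.2) @^-1` P ij.1 ij.2)).
  by move=> g Hg; apply: PW => i j; exact: (Hg (i, j)).
suff : F (fun g : SL3 R => forall ij : 'I_3 * 'I_3, P ij.1 ij.2 (\val g ij.1 ij.2)).
  by apply: filterS => g Hg ij _; exact: Hg.
by apply: filter_forall => -[i j]; apply: (Ha i j); exact: Pn.
Qed.

Lemma bigcup_bounded_SL3 : \bigcup_n bounded_SL3 n = setT.
Proof.
apply/seteqP; split => // g _.
have [n _ nS] := nat_ge (\sum_(ij : 'I_3 * 'I_3) `|\val (g : SL3 R) ij.1 ij.2|).
exists n => // i j; apply: le_trans nS.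
by rewrite (bigD1 (i, j)) //= lerDl sumr_ge0.
Qed.

Lemma haar_sigma_finite (mu : {measure set G3 -> \bar R}) :
  haar_measure mu -> sigma_finite setT mu.
Proof.
move=> [_ fin _]; exists bounded_SL3; first by rewrite bigcup_bounded_SL3.
by move=> n; split; [exact: measurable_bounded_SL3|apply: fin;
  exact: compact_bounded_SL3].
Qed.

Lemma measurable_mulmx d (T : measurableType d) m n p
    (A : T -> 'M[R]_(m, n)) (B : T -> 'M[R]_(n, p)) :
  (forall i j, measurable_fun setT (fun t => A t i j)) ->
  (forall i j, measurable_fun setT (fun t => B t i j)) ->
  forall i j, measurable_fun setT (fun t => (A t *m B t) i j).
Proof.
move=> mA mB i j; under eq_fun do rewrite mxE.
by apply: measurable_sum => k; apply: measurable_funM.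
Qed.

Lemma measurable_Q0 d (T : measurableType d) (v : T -> 'rV[R]_3) :
  (forall j, measurable_fun setT (fun t => v t 0 j)) ->
  measurable_fun setT (fun t => Q0 (v t)).
Proof.
move=> mv; apply: measurable_funB; last by apply: measurable_funX.
by apply: measurable_funD; apply: measurable_funX.
Qed.

(** * Forms that eventually hit every grid point, and measurability *)

Section Good.
Variable kappa : R.

Definition hit (g : SL3 R) (B xi d : R) := exists n : 'rV[int]_3,
  enorm (intvec R n) <= B /\ `|Qform g (intvec R n) - xi| < d.

Definition level (C i : nat) : set G3 := [set g | forall u sg,
  u%:R ^+ 2 * kappa ^+ i <= 4 ^+ i ->
  hit g (C%:R * (2 ^ i)%:R) (grid kappa i u sg) (precision kappa i u)].

(** [C] and [I] may depend on g: the bounds obtained from the parabolas are not uniform over the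
    group. *)
Definition good : set G3 :=
  [set g | exists C I : nat, forall i, (I <= i)%N -> level C i g].

(** Stated for any entrywise measurable map so as to cover both the identity and (h, s) |-> u_s h,
    the latter without relating the Borel sets of the group to the product sigma-algebra. *)
Lemma preimage_good d (T : measurableType d) (phi : T -> SL3 R) :
  (forall i j, measurable_fun setT (fun t => \val (phi t) i j)) ->
  measurable (phi @^-1` good).
Proof.
move=> mphi.
have mh B xi r : measurable [set t | hit (phi t) B xi r].
  rewrite (_ : mkset _ = \bigcup_(n : 'rV[int]_3)
     (if enorm (intvec R n) <= B then
       setT `&` (fun t => Qform (phi t) (intvec R n)) @^-1` (ball xi r) else set0)).
    apply: countable_bigcupT_measurable => // n; case: ifP => // _.
    have mQ : measurable_fun setT (fun t => Qform (phi t) (intvec R n)).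
      by apply: measurable_Q0 => j;
        apply: (@measurable_mulmx _ _ _ _ _ (fun=> intvec R n)).
    by apply: mQ => //; exact: measurable_ball.
  apply/seteqP; split => t /=.
    by move=> [n [nB nr]]; exists n => //; rewrite nB; split => //;
      rewrite /ball /= distrC.
  move=> [n _]; case: ifP => // nB [_]; rewrite /ball /= distrC => nr.
  by exists n.
have ml C i : measurable (phi @^-1` level C i).
  rewrite (_ : _ @^-1` _ = \bigcap_(us : nat * bool)
    if us.1%:R ^+ 2 * kappa ^+ i <= 4 ^+ i then
      [set t | hit (phi t) (C%:R * (2 ^ i)%:R) (grid kappa i us.1 us.2) (precision
        kappa i us.1)]
    else setT).
    by apply: countable_bigcapT_measurable => us; case: ifP.
  apply/seteqP; split => t Ht.
    by move=> [u sg] _ /=; case: ifP => // ui; exact: Ht.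
  by move=> u sg ui; have := Ht (u, sg) I; rewrite /= ui.
rewrite (_ : _ @^-1` _ = \bigcup_(CI : nat * nat) \bigcap_(i : nat)
   if (CI.2 <= i)%N then phi @^-1` level CI.1 i else setT).
  apply: countable_bigcupT_measurable => // CI.
  by apply: countable_bigcapT_measurable => i; case: ifP.
apply/seteqP; split => t.
  by move=> [C [I0 H]]; exists (C, I0) => // i _ /=; case: ifP => // /H.
by move=> [[C I0] _ H]; exists C, I0 => i Ii; have := H i I; rewrite /= Ii.
Qed.

Lemma measurable_good : measurable good.
Proof. exact: (@preimage_good _ G3 id measurable_entry). Qed.

End Good.
End SL3Measure.

(** * Shears fixing a negative lattice vector *)

Section Shear.
Context {R : realType}.
Local Notation MR := (measurableTypeR R).
Local Notation G3 := (borelSL3 R).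

Lemma torus_negligible_boxC : (@torus R).-negligible (~` box).
Proof.
have mb := @measurable_box R.
exists (~` box); split; [exact: measurableC| |by []].
rewrite probability_setC //.
by rewrite -[X in (_ - X)%E](esym (@torus_box R)) subee.
Qed.

Definition shear (s : MR * MR) : 'M[R]_3 :=
  \matrix_(i, j) (if i == j then 1 else
    if (i == 0) && (j == 2) then s.1 else if (i == 1) && (j == 2) then s.2 else 0).

Lemma det_shear s : \det (shear s) = 1.
Proof. by rewrite det_mx33 !mxE /=; ring. Qed.

Lemma row3_shear x y z s :
  row3 x y z *m shear s = row3 x y (z + (x * s.1 + y * s.2)).
Proof.
apply/rowP => j; rewrite row3_mulmx !mxE.
by case: j => -[|[|[|j]]] //= ?; ring.
Qed.

Lemma row2E (M : 'M[R]_3) : row 2 M = row3 0 0 1 *m M.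
Proof. by apply/rowP => j; rewrite row3_mulmx mxE; ring. Qed.

Variable gam : 'M[int]_3.
Hypothesis gam0 : \det gam != 0.
Let G : 'M[R]_3 := map_mx intr gam.

Lemma unit_gam : G \in unitmx.
Proof. by rewrite unitmxE unitfE det_map_mx intr_eq0. Qed.

Fact det_conj_shear s : \det (invmx G *m shear s *m G) = 1.
Proof.
by rewrite !det_mulmx det_shear mulr1 -det_mulmx mulVmx ?det1 // unit_gam.
Qed.

(** The rows of [gam] are the vectors a, b, c, and this is u_s. A nonzero determinant suffices,
    because the integer vectors produced only have to lie in the lattice spanned by these rows. *)
Definition conj_shear (s : MR * MR) : SL3 R := SL3_of (det_conj_shear s).

Lemma gam_conj_shear s (h : SL3 R) :
  G *m \val (conj_shear s * h)%g = shear s *m (G *m \val h).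
Proof. by rewrite /= !mulmxA mulmxV ?mul1mx // unit_gam. Qed.

Lemma measurable_conj_shear (i j : 'I_3) :
  measurable_fun setT (fun s => \val (conj_shear s) i j).
Proof.
apply: (@measurable_mulmx R _ _ _ _ _ (fun s => invmx G *m shear s) (fun=> G))
  => // {}i {}j.
apply: (@measurable_mulmx R _ _ _ _ _ (fun=> invmx G) shear) => // {}i {}j.
have -> : (fun s => shear s i j) = (fun s : MR * MR => (if i == j then 1 else
    if (i == 0) && (j == 2) then s.1 else if (i == 1) && (j == 2) then s.2 else 0) : R).
  by apply/funext => s; rewrite mxE.
case: (i == j); first exact: measurable_cst.
case: ((i == 0) && _); first exact: measurable_fst.
by case: ((i == 1) && _); [exact: measurable_snd|exact: measurable_cst].
Qed.

Definition timelike : set G3 := [set h : SL3 R | Q0 (row 2 (G *m \val h)) < 0].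

Lemma timelike_conj_shear s (h : SL3 R) :
  timelike (conj_shear s * h)%g = timelike h.
Proof.
have tE (h' : SL3 R) : timelike h' = (Q0 (row 2 (G *m \val h')) < 0) by [].
by rewrite !tE gam_conj_shear !row2E mulmxA row3_shear !mul0r !addr0.
Qed.

Lemma measurable_timelike : measurable timelike.
Proof.
rewrite (_ : timelike = setT `&`
    (fun h : G3 => Q0 (row 2 (G *m \val (h : SL3 R)))) @^-1` `]-oo, 0[%classic).
  have : measurable_fun setT (fun h : G3 => Q0 (row 2 (G *m \val (h : SL3 R)))).
    apply: measurable_Q0 => j; under eq_fun do rewrite mxE.
    apply: (@measurable_mulmx R _ _ _ _ _ (fun=> G)
      (fun h : G3 => \val (h : SL3 R))) => //.
    exact: measurable_entry.
  by apply.
by rewrite setTI; apply/seteqP; split => h; rewrite /timelike /= in_itv.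
Qed.

Lemma enorm_le_sum (v : 'rV[R]_3) : enorm v <= \sum_j `|v 0 j|.
Proof.
have S0 : 0 <= \sum_j `|v 0 j| by exact: sumr_ge0.
rewrite /enorm -[leRHS]ger0_norm // -sqrtr_sqr ler_sqrt ?sqr_ge0 //.
rewrite !big_ord_recl !big_ord0 /=.
have h (a b c : R) : a ^+ 2 + (b ^+ 2 + (c ^+ 2 + 0)) <=
    (`|a| + (`|b| + (`|c| + 0))) ^+ 2.
  rewrite -(real_normK (num_real a)) -(real_normK (num_real b)) -(real_normK (num_real
    c)).
  have := normr_ge0 a; have := normr_ge0 b; have := normr_ge0 c.
  by move: `|a| `|b| `|c| => x y z; nra.
exact: h.
Qed.

Lemma gam_enorm : exists D : nat, forall (l1 l2 m : int) (B : R),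
  `|l1%:~R| <= B -> `|l2%:~R| <= B -> `|m%:~R| <= B ->
  exists2 n : 'rV[int]_3, intvec R n = row3 l1%:~R l2%:~R m%:~R *m G &
    enorm (intvec R n) <= D%:R * B.
Proof.
have [D _ hD] := nat_ge (\sum_j (`|G 0 j| + `|G 1 j| + `|G 2 j|)).
exists D => l1 l2 m B h1 h2 h3.
pose w : 'rV[int]_3 := \row_j (if j == 0 then l1 else if j == 1 then l2 else m).
have wE : intvec R (w *m gam) = row3 l1%:~R l2%:~R m%:~R *m G.
  rewrite /intvec map_mxM; congr (_ *m _); apply/rowP => j; rewrite !mxE.
  by do 2 case: ifP => // _.
exists (w *m gam) => //.
have B0 : 0 <= B := le_trans (normr_ge0 _) h1.
apply: le_trans (enorm_le_sum _) _; apply: le_trans (ler_wpM2r B0 hD).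
rewrite mulr_suml; apply: ler_sum => j _; rewrite wE row3_mulmx !mulrDl.
apply: le_trans (ler_normD _ _) _; apply: lerD.
  apply: le_trans (ler_normD _ _) _.
  by apply: lerD; rewrite normrM mulrC ler_wpM2l.
by rewrite normrM mulrC ler_wpM2l.
Qed.

Variable kappa : R.
Hypotheses (kappa_gt : 2^-1 < kappa) (kappa_lt1 : kappa < 1).

(** The rows of [H] are the images of a, b, c under h, so replacing h by u_s h amounts to replacing
    m by m + l.s in [F]. The constant D converts bounds on the coordinates (l, m) into Euclidean
    norms. *)
Lemma ae_conj_shear_good (h : SL3 R) : timelike h ->
  torus.-negligible [set s | box s /\ ~ good kappa (conj_shear s * h)%g].
Proof.
move=> th; pose H := G *m \val h.
have detH : \det H != 0.
  by rewrite det_mulmx det_SL3 mulr1 det_map_mx intr_eq0.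
pose al := H 2 2 ^+ 2 - H 2 0 ^+ 2 - H 2 1 ^+ 2.
have al0 : 0 < al.
  have rE j : row 2 H 0 j = H 2 j by rewrite mxE.
  by have : Q0 (row 2 H) < 0 := th; rewrite /Q0 !rE /al; lra.
have al1 : al != 0 by rewrite gt_eqF.
rewrite det_mx33 in detH.
have [e e0 qe] := @quotient_form_ge R _ _ _ _ _ _ _ _ _ al0 detH.
pose F (l1 l2 : int) (y : R) := Q0 (row3 l1%:~R l2%:~R y *m H).
have [C mF missF] : exists2 C : nat,
    (forall B xi d, measurable (missed F B xi d)) &
    forall (K : nat) (xi d : R), (0 < K)%N -> `|xi| <= K%:R ^+ 2 ->
      0 < d -> d <= K%:R ->
      (torus (missed F (C%:R * K%:R) xi d) <= (C%:R / (K%:R * d))%:E)%E.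
  have FQ l1 l2 y : F l1 l2 y =
    (l1%:~R * H 0 0 + l2%:~R * H 1 0 + y * H 2 0) ^+ 2 +
    (l1%:~R * H 0 1 + l2%:~R * H 1 1 + y * H 2 1) ^+ 2 -
    (l1%:~R * H 0 2 + l2%:~R * H 1 2 + y * H 2 2) ^+ 2.
    by rewrite /F /Q0 !row3_mulmx.
  have FE := fun l1 l2 y => etrans (FQ l1 l2 y)
    (complete_square (H 0 0) (H 0 1) (H 0 2) (H 1 0) (H 1 1) (H 1 2) _ _ y al1).
  have [C miss] := torus_missed al0 e0 qe FE.
  by exists C => // B xi d; exact: (measurable_missed FE).
have [D hD] := gam_enorm.
apply: negligibleS (ae_eventually_hit kappa_gt kappa_lt1 mF missF).
move=> s [bs ngood]; split => //; apply: contra_not ngood => -[I0 HI].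
exists (D * C)%N, I0 => i Ii u sg ui.
have [l1 [l2 [m [h1 h2 h3 hF]]]] := HI i Ii u sg ui.
have [n nE nle] := hD _ _ _ _ h1 h2 h3.
exists n; split; first by rewrite natrM -mulrA.
move: hF; rewrite /F /Qform nE -mulmxA gam_conj_shear mulmxA row3_shear.
by rewrite /H /ldot.
Qed.

(** Integrate the indicator of u_s h in B over (h, s). For fixed s the result is mu B, by left
    invariance, and the torus has mass 1; for fixed h it is 0, because [timelike] is invariant under
    the shears. Sigma-finiteness makes Tonelli's theorem available. *)
Lemma haar_timelike_good (mu : {measure set G3 -> \bar R}) :
  haar_measure mu -> mu (timelike `\` good kappa) = 0%E.
Proof.
move=> mu_haar; have [inv _ _] := mu_haar.
have sf := haar_sigma_finite mu_haar.
pose H1 := isSFinite.Build _ _ _ _ (sfinite_measure_sigma_finite sf).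
pose H2 := isSigmaFinite.Build _ _ _ _ sf.
pose mu' := HB.pack_for (SigmaFiniteMeasure.type G3 R) (Measure.sort mu) H1 H2.
set B := timelike `\` good kappa.
have mB : measurable B
  by apply: measurableD; [exact: measurable_timelike|exact: measurable_good].
pose phi (w : G3 * (MR * MR)) : SL3 R := (conj_shear w.2 * (w.1 : SL3 R))%g.
have mphi i j : measurable_fun setT (fun w => \val (phi w) i j).
  apply: (@measurable_mulmx R _ _ _ _ _
    (fun w : G3 * (MR * MR) => \val (conj_shear w.2))
    (fun w : G3 * (MR * MR) => \val (w.1 : SL3 R))) => {}i {}j.
    exact: (measurableT_comp (measurable_conj_shear i j) measurable_snd).
  exact: (measurableT_comp (measurable_entry i j) measurable_fst).
pose W := phi @^-1` B.
have mW : measurable W.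
  rewrite (_ : W = (timelike `*` setT) `\` (phi @^-1` good kappa)).
    apply: measurableD; last exact: preimage_good.
    by apply: measurableX => //; exact: measurable_timelike.
  apply/seteqP; split => -[h s] /=; rewrite /W /B /preimage /= /phi /=.
    by rewrite timelike_conj_shear => -[].
  by rewrite timelike_conj_shear => -[[]].
have mI : measurable_fun setT (fun w => (\1_W w)%:E : \bar R).
  by apply/measurable_EFinP/measurable_indic.
have muB s : (\int[mu']_h (\1_W (h, s))%:E = mu B)%E.
  rewrite (_ : (fun h => _) = (fun h => (\1_[set h | W (h, s)] h)%:E)) //.
  have mWs : measurable [set h | W (h, s)].
    by have := measurable_ysection s mW; rewrite ysectionE.
  rewrite integral_indic // setIT /= -(inv (conj_shear s)); last first.
    exact: mWs.
  congr (mu _); apply/seteqP; split => g.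
    by move=> [h hW <-].
  move=> gB; exists ((conj_shear s)^-1 * g)%g; last by rewrite mulVKg.
  by rewrite /W /preimage /= /phi /= mulVKg.
have W0 (h : G3) : (\int[torus]_s (\1_W (h, s))%:E = 0)%E.
  have mWh : measurable [set s | W (h, s)].
    by have := measurable_xsection h mW; rewrite xsectionE.
  rewrite (_ : (fun s => _) = (fun s => (\1_[set s | W (h, s)] s)%:E)) //.
  rewrite integral_indic // setIT; apply: measure_negligible => //.
  have [th|nth] := pselect (timelike h); last first.
    rewrite (_ : mkset _ = set0); first exact: negligible_set0.
    apply/seteqP; split => // s; rewrite /W /preimage /= /phi /B /= => -[].
    by rewrite timelike_conj_shear.
  have := negligibleU (ae_conj_shear_good th) torus_negligible_boxC.
  apply: negligibleS => s; rewrite /W /preimage /= /phi /B /= => -[_ ng].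
  by have [bs|nbs] := pselect (box s); [left|right].
transitivity (\int[torus]_s \int[mu']_h (\1_W (h, s))%:E)%E.
  under eq_integral do rewrite muB.
  by rewrite integral_cst // -[LHS]mule1; congr (_ * _)%E; exact/esym/probability_setT.
rewrite -(fubini_tonelli (fun w => (\1_W w)%:E)) //.
by under eq_integral do rewrite W0; rewrite integral0.
Qed.
End Shear.

(** * Proof of the theorem *)

Section Covering.
Context {R : realType}.

(** The rows are e_1, e_2 and the candidate for c, so that independence reduces to the last
    coordinate being nonzero. *)
Definition unit_rows (abc : int * int * int) : 'M[int]_3 :=
  \matrix_(i, j) (if i == 2 then
      (if j == 0 then abc.1.1 else if j == 1 then abc.1.2 else abc.2)
    else (i == j)%:R).

Lemma det_unit_rows abc : \det (unit_rows abc) = abc.2.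
Proof. by rewrite det_mx33 !mxE /=; ring. Qed.

Lemma row2_unit_rows abc (h : 'M[R]_3) :
  row 2 (map_mx intr (unit_rows abc) *m h) =
  row3 abc.1.1%:~R abc.1.2%:~R abc.2%:~R *m h.
Proof.
rewrite row2E mulmxA; congr (_ *m _); apply/rowP => j.
rewrite row3_mulmx !mxE /= !mul0r !add0r mul1r.
by do 2 case: ifP => // _.
Qed.

(** Round T x to an integer vector, where x h = e_3. Rounding moves each coordinate of the image by
    at most S, so with T = 3 S + 1 the form is at most 2 S^2 - (2 S + 1)^2 < 0. *)
Lemma exists_timelike (h : SL3 R) :
  exists2 abc, abc.2 != 0 & timelike (unit_rows abc) h.
Proof.
pose x := row3 0 0 1 *m invmx (\val h).
have uh : \val h \in unitmx by rewrite unitmxE det_SL3 unitr1.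
have xh : x *m \val h = row3 0 0 1 by rewrite mulmxKV.
pose S := \sum_(ij : 'I_3 * 'I_3) `|\val h ij.1 ij.2|.
have S0 : 0 <= S by apply: sumr_ge0.
pose T := 3 * S + 1.
have fl (t : R) : `|(Num.floor t)%:~R - t| <= 1.
  rewrite ler_norml; have := floor_le_tmp t; have := floorD1_gt t.
  by rewrite intrD => a b; apply/andP; split; lra.
have [a ha] : exists a : int, `|a%:~R - T * x 0 0| <= 1 by eexists; exact: fl.
have [b hb] : exists b : int, `|b%:~R - T * x 0 1| <= 1 by eexists; exact: fl.
have [c c0 hc] : exists2 c : int, c != 0 & `|c%:~R - T * x 0 2| <= 1.
  (* A floor equal to 0 places the coordinate in [0, 1), where 1 is an equally good rounding. *)
  have [f0|f0] := eqVneq (Num.floor (T * x 0 2)) 0; last first.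
    by exists (Num.floor (T * x 0 2)) => //; exact: fl.
  exists 1 => //; have := floor_le_tmp (T * x 0 2); have := floorD1_gt (T * x 0 2).
  by rewrite f0 add0r ler_norml => p q; apply/andP; split; lra.
exists (a, b, c) => //; rewrite /timelike /= row2_unit_rows /Q0 !row3_mulmx /=.
pose w j := (a%:~R - T * x 0 0) * \val h 0 j + (b%:~R - T * x 0 1) * \val h 1 j
  + (c%:~R - T * x 0 2) * \val h 2 j.
have vE j : a%:~R * \val h 0 j + b%:~R * \val h 1 j + c%:~R * \val h 2 j =
    T * (if j == 2 then 1 else 0) + w j.
  have : (x *m \val h) 0 j = (if j == 2 then 1 else 0).
    by rewrite xh mxE; case: j => -[|[|[|j]]].
  have -> : (x *m \val h) 0 j =
      x 0 0 * \val h 0 j + x 0 1 * \val h 1 j + x 0 2 * \val h 2 j.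
    rewrite mxE !big_ord_recl big_ord0 addr0 addrA.
    by congr (x 0 _ * \val h _ j + x 0 _ * \val h _ j + x 0 _ * \val h _ j);
      apply: val_inj.
  by move=> <-; rewrite /w; ring.
have wS j : `|w j| <= S.
  have : `|\val h 0 j| + `|\val h 1 j| + `|\val h 2 j| <= S.
    rewrite /S (bigD1 (0, j)) //= (bigD1 (1, j)) //= (bigD1 (2, j)) //= !addrA lerDl.
    exact: sumr_ge0.
  apply: le_trans; apply: le_trans (ler_normD _ _) _; apply: lerD.
    apply: le_trans (ler_normD _ _) _.
    by apply: lerD; rewrite normrM ler_piMl.
  by rewrite normrM ler_piMl.
rewrite !vE /= !mulr0 !add0r mulr1.
have := wS 0; have := wS 1; have := wS 2; rewrite !ler_norml.
move: (w 0) (w 1) (w 2) => w0 w1 w2 /andP[p2 q2] /andP[p1 q1] /andP[p0 q0].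
have h0 : w0 ^+ 2 <= S ^+ 2 by nra.
have h1 : w1 ^+ 2 <= S ^+ 2 by nra.
have h2 : (2 * S + 1) ^+ 2 <= (T + w2) ^+ 2 by rewrite /T; nra.
by nra.
Qed.

Lemma ae_good (kappa : R) (mu : {measure set (borelSL3 R) -> \bar R}) :
  2^-1 < kappa -> kappa < 1 -> haar_measure mu ->
  mu.-negligible (~` good kappa).
Proof.
move=> k1 k2 mu_haar.
pose F n : set (borelSL3 R) := if unpickle n is Some abc then
  if abc.2 != 0 then timelike (unit_rows abc) `\` good kappa else set0 else set0.
apply: (@negligibleS _ _ _ _ (\bigcup_n F n)).
  move=> h ngh; have [abc c0 th] := exists_timelike h.
  exists (pickle abc); first exact: I.
  by rewrite /F pickleK c0; split; [exact: th|exact: ngh].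
apply: negligible_bigcup => n; rewrite /F; case: unpickle => [abc|]; last first.
  exact: negligible_set0.
case: ifPn => c0; last exact: negligible_set0.
apply/negligibleP.
  by apply: measurableD; [exact: measurable_timelike|exact: measurable_good].
by apply: haar_timelike_good => //; rewrite det_unit_rows.
Qed.

(** * From grid points to all targets at a given k *)

Section Deterministic.
Variables (N delta : nat -> R) (eta : R).
Hypothesis eta_gt0 : 0 < eta.
Hypothesis eta_lt1 : eta < 1.
Hypothesis N_gt0 : forall k, (0 < k)%N -> 0 < N k.
Hypothesis delta_gt0 : forall k, (0 < k)%N -> 0 < delta k.
Let kappa : R := (2 `^ eta)^-1.

Lemma kappa_bounds : 2^-1 < kappa < 1.
Proof.
have b1 : 1 < 2 `^ eta.
  have := @gt0_ltr_powR R eta eta_gt0 1 2; rewrite powR1 !nnegrE; apply => //.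
  by rewrite ltr1n.
have b2 : 2 `^ eta < 2.
  rewrite -[ltRHS]powRr1 //; rewrite /powR pnatr_eq0 /= ltr_expR ltr_pM2r //.
  by rewrite ln_gt0 // ltr1n.
have b0 : 0 < 2 `^ eta := lt_trans ltr01 b1.
by rewrite /kappa ltf_pV2 ?posrE // b2 invf_lt1.
Qed.

(** Passing from k to its dyadic scale 2^i costs at most 2^eta <= 2. *)
Lemma powR_le_kappa (k i : nat) : (k < 2 ^ i.+1)%N -> k%:R `^ eta * kappa ^+ i <= 2.
Proof.
move=> ki; have /andP[_ _] := kappa_bounds.
have b0 : 0 < 2 `^ eta by rewrite powR_gt0.
have : k%:R `^ eta <= (2 `^ eta) ^+ i.+1.
  rewrite -powR_mulrn ?powR_ge0 // -powRrM mulrC powRrM powR_mulrn //.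
  apply: ge0_ler_powR; [exact: ltW|by rewrite nnegrE|by rewrite nnegrE exprn_ge0|].
  by rewrite -(natrX R) ler_nat ltnW.
have b2 : 2 `^ eta <= 2 by apply: ler1_powR; [rewrite ler1n|exact: ltW].
move=> h; apply: le_trans b2; rewrite /kappa exprVn ler_pdivrMr ?exprn_gt0 //.
by rewrite -exprS.
Qed.

(** The constants 1/32 and 1/2 are chosen so that, after the loss of 2 in passing to th = kappa^i,
    they read 16 n th <= d^2 and n^(3/2) th <= d. *)
Lemma good_maxmin_le (g : SL3 R) (C i k : nat) :
  (2 ^ i <= k < 2 ^ i.+1)%N -> level kappa C i g ->
  N k / (k%:R `^ eta * delta k ^+ 2) <= 1 / 32 ->
  N k `^ (3 / 2) / (k%:R `^ eta * delta k) <= 1 / 2 ->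
  (maxmin (Qform g) (N k) (C.+1%:R * k%:R) <= (delta k)%:E)%E.
Proof.
move=> /andP[ik ki] Hlev r1 r2.
have /andP[kap1 kap2] := kappa_bounds.
have k0 : (0 < k)%N by apply: leq_trans ik; rewrite expn_gt0.
have Nk := N_gt0 k0; have dk := delta_gt0 k0.
set n := N k in Nk r1 r2 *; set d := delta k in dk r1 r2 *.
apply: ge_ereal_sup => _ [xi /= xiN <-].
suff [v [vk vd]] : exists v : 'rV[int]_3,
    enorm (intvec R v) <= C.+1%:R * k%:R /\ `|Qform g (intvec R v) - xi| <= d.
  by apply: ge_ereal_inf; exists (`|Qform g (intvec R v) - xi|%:E) => //; exists v.
(* If n <= d, the zero vector is within d of every target. Otherwise d < n is available for
   cancelling n below. *)
have [nd|dn] := leP n d.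
  exists 0; have -> : intvec R 0 = 0 by rewrite /intvec map_mx0.
  rewrite /enorm /Qform mul0mx /Q0 !mxE !expr0n /= subr0 addr0 sub0r normrN; split.
    rewrite big1 ?sqrtr0 ?mulr_ge0 // => j _; by rewrite mxE expr0n.
  exact: le_trans xiN nd.
set th := kappa ^+ i.
have kap0 : 0 < kappa by apply: lt_trans kap1; rewrite invr_gt0.
have th0 : 0 < th by rewrite exprn_gt0.
have P := powR_le_kappa ki; rewrite -/th in P.
have p0 : 0 < k%:R `^ eta by rewrite powR_gt0 // ltr0n.
set p := k%:R `^ eta in p0 P r1 r2 *.
have {}r1 : 16 * (n * th) <= d ^+ 2.
  move: r1; rewrite ler_pdivrMr ?mulr_gt0 ?exprn_gt0 // => r1.
  have := ler_wpM2r (ltW th0) r1.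
  have : p * th * d ^+ 2 <= 2 * d ^+ 2 by rewrite ler_wpM2r // sqr_ge0.
  lra.
(* From n sqrt(n) th <= d < n. Together with th >= 2^-i this gives n <= 4^i, the range of the
   grid. *)
have r3 : Num.sqrt n * th <= 1.
  move: r2; rewrite ler_pdivrMr ?mulr_gt0 //.
  have -> : 3 / 2 = 1 + 2^-1 :> R by field.
  rewrite powRD; last by rewrite gt_eqF ?implybT.
  rewrite powRr1 ?(ltW Nk) // powR12_sqrt ?(ltW Nk) // => r2.
  have := ler_wpM2r (ltW th0) r2.
  have : p * th * d <= 2 * d by rewrite ler_wpM2r // ltW.
  have s0 : 0 <= Num.sqrt n * th by rewrite mulr_ge0 ?sqrtr_ge0 // ltW.
  have : n * (Num.sqrt n * th) <= n * 1 -> Num.sqrt n * th <= 1 by rewrite ler_pM2l.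
  by move=> cancel a b; apply: cancel; move: s0 a b; lra.
have nth : n * th ^+ 2 <= 1.
  have := sqr_sqrtr (ltW Nk) => e; rewrite -e -exprMn expr_le1 //.
  by rewrite mulr_ge0 ?sqrtr_ge0 // ltW.
have th2 : 1 <= th * 2 ^+ i.
  rewrite /th -exprMn exprn_ege1 //; lra.
(* From 16 n th <= d^2 < d n; this handles the targets near 0, where the precision is th itself. *)
have d16 : 16 * th <= d by nra.
(* xi is approximated by the grid point sg(xi) u^2 th with u = floor(sqrt(|xi|/th)) *)
pose u := Num.truncn (Num.sqrt (`|xi| / th)).
pose y := Num.sqrt (`|xi| / th).
have y0 : 0 <= y := sqrtr_ge0 _.
have yy : y ^+ 2 * th = `|xi|.
  by rewrite sqr_sqrtr ?divr_ge0 ?(ltW th0) // divfK // gt_eqF.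
have /andP[uy yu] : u%:R <= y < u.+1%:R by exact: truncn_itv.
rewrite -natr1 in yu.
have u0 : 0 <= u%:R :> R by [].
have uxi : u%:R ^+ 2 * th <= `|xi| by rewrite -yy ler_wpM2r ?(ltW th0) //; nra.
have ui : u%:R ^+ 2 * th <= 4 ^+ i.
  apply: le_trans uxi _; apply: le_trans xiN _.
  have -> : 4 ^+ i = (2 ^+ i) ^+ 2 :> R
    by rewrite -exprM mulnC exprM; congr (_ ^+ i); rewrite -natrX.
  have t0 : 0 < th ^+ 2 by rewrite exprn_gt0.
  rewrite -(ler_pM2r t0) -exprMn (le_trans nth) // mulrC.
  by rewrite exprn_ege1.
have [v [vC vp]] := Hlev u (xi < 0) ui.
exists v; split.
  apply: le_trans vC _; apply: ler_pM => //; by rewrite ler_nat.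
pose m : R := (maxn u 1)%:R.
have um : u%:R <= m by rewrite ler_nat leq_maxl.
have m1 : 1 <= m by rewrite -[1]/(1%:R) ler_nat leq_maxr.
have gd : `|grid kappa i u (xi < 0) - xi| <= 3 * m * th.
  rewrite /grid -/th; have -> : (-1) ^+ (xi < 0)%R * (u%:R ^+ 2 * th) - xi =
      (-1) ^+ (xi < 0)%R * (u%:R ^+ 2 * th - `|xi|).
    by rewrite mulrBr -[X in _ = _ - X]realEsign ?num_real.
  rewrite normrM normr_sign mul1r distrC ger0_norm ?subr_ge0 // -yy.
  rewrite -mulrBl ler_wpM2r ?(ltW th0) //; nra.
(* The gap to the grid point takes 3 m th, as (u + 1)^2 - u^2 = 2 u + 1 <= 3 m, and the precision of
   the hit takes m th. For u > 1, squaring leads to 16 |xi| th <= 16 n th <= d^2. *)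
have md : 4 * m * th <= d.
  have [um1|u1] := leqP u 1.
    rewrite /m (maxn_idPr um1) mulr1; lra.
  have mu' : m = u%:R by rewrite /m (maxn_idPl (ltnW u1)).
  rewrite mu' -(@ler_pXn2r _ 2) ?nnegrE ?mulr_ge0 ?(ltW th0) ?(ltW dk) //.
  apply: le_trans r1; rewrite !exprMn.
  have : u%:R ^+ 2 * th * th <= n * th.
    by rewrite ler_wpM2r ?(ltW th0) // (le_trans uxi).
  rewrite expr2; nra.
rewrite -(subrKA (grid kappa i u (xi < 0))) (le_trans (ler_normD _ _)) //.
move: vp; rewrite /precision -/m -/th; lra.
Qed.

End Deterministic.
End Covering.

Theorem theorem1p1 (R : realType) (N delta : nat -> R)
  (N_gt0 : forall k, (0 < k)%N -> 0 < N k)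
  (delta_gt0 : forall k, (0 < k)%N -> 0 < delta k)
  (rates : exists eta : R, [/\ eta < 1,
     N k / (k%:R `^ eta * delta k ^+ 2) @[k --> \oo] --> 0
   & N k `^ (3 / 2) / (k%:R `^ eta * delta k) @[k --> \oo] --> 0])
  (mu : {measure set (borelSL3 R) -> \bar R}) (mu_haar : haar_measure mu) :
  {ae mu, forall g : SL3 R,
    exists c T0 : R, [/\ 0 < c, 0 < T0 &
      forall k : nat, T0 <= k%:R ->
        (maxmin (Qform g) (N k) (c * k%:R) <= (delta k)%:E)%E]}.
Proof.
have [eta0 [eta01 lim1 lim2]] := rates.
(* [eta0] may be nonpositive, while kappa < 1 needs a positive exponent. Raising the exponent only
   decreases the two ratios, since k >= 1. *)
pose eta := Num.max eta0 (1 / 2).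
have eta_gt0 : 0 < eta by rewrite lt_max divr_gt0 ?orbT.
have eta_lt1 : eta < 1 by rewrite gt_max eta01 /=; lra.
have /andP[kap1 kap2] := kappa_bounds eta_gt0 eta_lt1.
have mono (k : nat) (x y : R) : (0 < k)%N -> 0 <= x -> 0 < y ->
    x / (k%:R `^ eta * y) <= x / (k%:R `^ eta0 * y).
  move=> k0 x0 y0; apply: ler_wpM2l => //.
  have pk e : 0 < k%:R `^ e by rewrite powR_gt0 // ltr0n.
  have pos e : k%:R `^ e * y \is Num.pos by rewrite posrE mulr_gt0 ?pk.
  rewrite (lef_pV2 (pos _) (pos _)) (ler_pM2r y0).
  by apply: ler_powR; [rewrite ler1n|rewrite /eta le_max lexx].
have [M1 _ HM1] : \forall k \near \oo, N k / (k%:R `^ eta0 * delta k ^+ 2) <= 1 / 32.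
  by apply: (cvgr_le _ lim1); rewrite divr_gt0.
have [M2 _ HM2] : \forall k \near \oo,
    N k `^ (3 / 2) / (k%:R `^ eta0 * delta k) <= 1 / 2.
  by apply: (cvgr_le _ lim2); rewrite divr_gt0.
apply: negligibleS (ae_good kap1 kap2 mu_haar) => g /=; apply: contra_not.
move=> [C [I0 HI]].
(* [C.+1] is positive even when C = 0. Beyond 2^I0 the dyadic level of k is at least [I0]; [M1] and
   [M2] are the thresholds from the two limits. *)
exists C.+1%:R, (M1 + M2 + 2 ^ I0).+1%:R; split; rewrite ?ltr0n // => k.
rewrite ler_nat => Mk.
have k0 : (0 < k)%N := leq_trans (ltn0Sn _) Mk.
have N0 := N_gt0 k k0; have d0 := delta_gt0 k k0.
have /= tb := @trunc_log_bounds 2 k isT k0.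
apply: (@good_maxmin_le R N delta eta eta_gt0 eta_lt1 N_gt0 delta_gt0 g C (trunc_log 2
  k) k tb).
- apply: HI; apply: trunc_log_max => //; lia.
- apply: le_trans (mono k _ _ k0 (ltW N0) _) (HM1 k _); first by rewrite exprn_gt0.
  by rewrite /=; lia.
- apply: le_trans (mono k _ _ k0 (powR_ge0 _ _) d0) (HM2 k _).
  by rewrite /=; lia.
Qed.
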